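(* Let $\beta\in(0,\pi)$, $\theta\in\mathbb{R}$, and let $f_\beta=h_\beta+\overline{g_\beta}\in K_H^0$ be a harmonic mapping of $E$ with $$h_\beta(z)+g_\beta(z)=\frac{1}{2i\sin\beta}\log\left(\frac{1+ze^{i\beta}}{1+ze^{-i\beta}}\right)$$ and with dilatation $\omega_2(z)=g_\beta'(z)/h_\beta'(z)=e^{i\theta}z^2$. Let $F_a=H_a+\overline{G_a}$ be the right half-plane mapping with $$H_a(z)=\frac{\frac{1}{1+a}z-\frac12z^2}{(1-z)^2},\qquad G_a(z)=\frac{\frac{a}{1+a}z-\frac12z^2}{(1-z)^2}.$$ Then, for $a\in[0,1)$, the harmonic convolution $F_a\ast f_\beta$ belongs to $S_H^0$ and is convex in the direction of the real axis.
   Context: $E=\{z\in\mathbb{C}:|z|<1\}$. $S_H$ is the class of all harmonic, sense-preserving, univalent mappings $f=h+\overline{g}$ in $E$ ($h,g$ analytic in $E$, with $h(0)=g(0)=0$) normalized by $f(0)=0$ and $f_z(0)=1$. $S_H^0$ is the subclass of $f\in S_H$ with $f_{\overline z}(0)=0$. $K_H^0$ is the subclass of $S_H^0$ consisting of functions that map $E$ onto convex domains. The dilatation of $f=h+\overline{g}$ is $\omega=g'/h'$. The logarithm is the analytic branch on $E$ vanishing at $z=0$. The harmonic convolution of $F=H+\overline{G}$ and $f=h+\overline{g}$ is $F\ast f=H\ast h+\overline{G\ast g}$, where for power series $\sum_{n\ge1} A_nz^n$ and $\sum_{n\ge1} a_nz^n$ analytic in $E$ the Hadamard product is $\sum_{n\ge1}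 A_na_nz^n$. A domain $\Omega$ is convex in a direction $\phi$, $0\le\phi<\pi$, if every line parallel to the line joining $0$ and $e^{i\phi}$ has a connected intersection with $\Omega$. A univalent mapping of $E$ is convex in the direction of the real axis if its image of $E$ is convex in the direction $\phi=0$. The mapping $F_a$, $a\in(-1,1)$, satisfies $H_a(z)+G_a(z)=z/(1-z)$ and has dilatation $G_a'(z)/H_a'(z)=(a-z)/(1-az)$.
   Formalization: Membership in S_H^0 is proved for (1+a)(F_a∗f_β), since F_a∗f_β has f_z(0)=1/(1+a), which is not 1 when 0<a<1; univalence and convexity in the direction of the real axis are proved for F_a∗f_β itself. *)

(* Defs.v *)
From Stdlib Require Import Reals Factorial.
From Coquelicot Require Import Coquelicot.
Open Scope R_scope.

Definition unit_disk (z : C) : Prop := Cmod z < 1.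

Definition Cexp (z : C) : C :=
  (exp (Re z) * cos (Im z), exp (Re z) * sin (Im z)).

Definition analytic_in_disk (f : C -> C) : Prop :=
  forall z : C, unit_disk z ->
    ex_derive (K := C_AbsRing) (V := C_NormedModule) f z.

Definition is_log_branch (q L : C -> C) : Prop :=
  analytic_in_disk L /\ L 0 = 0 /\
  forall z : C, unit_disk z -> Cexp (L z) = q z.

(** ** Planar sets *)

Definition convex_set (Omega : C -> Prop) : Prop :=
  forall (w1 w2 : C) (t : R), Omega w1 -> Omega w2 -> 0 <= t <= 1 ->
    Omega ((1 - t)%R * w1 + t * w2)%C.

Definition connected_set (S : C -> Prop) : Prop :=
  ~ exists U V : C -> Prop,
      open U /\ open V /\
      (forall w : C, S w -> U w \/ V w) /\
      (exists w : C, S w /\ U w) /\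
      (exists w : C, S w /\ V w) /\
      (forall w : C, S w -> ~ (U w /\ V w)).

(** The line through [p] parallel to the line joining [0] and [e^(i phi)]. *)
Definition line (phi : R) (p w : C) : Prop :=
  exists t : R, w = (p + t * Cexp (Ci * phi))%C.

Definition convex_in_direction (phi : R) (Omega : C -> Prop) : Prop :=
  forall p : C, connected_set (fun w => line phi p w /\ Omega w).

(** ** Harmonic mappings of the disk *)

(** The data of [f = h + conj g].  Functions are total on [C], but only their
    values on the disk are meaningful. *)
Record harmonic_map : Type := HarmonicMap {
  hpart : C -> C;
  gpart : C -> C
}.

Definition hval (f : harmonic_map) (z : C) : C :=
  (hpart f z + Cconj (gpart f z))%C.
Coercion hval : harmonic_map >-> Funclass.

Definition disk_image (f : C -> C) (w : C) : Prop :=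
  exists z : C, unit_disk z /\ f z = w.

Definition univalent (f : C -> C) : Prop :=
  forall z1 z2 : C, unit_disk z1 -> unit_disk z2 -> f z1 = f z2 -> z1 = z2.

Definition dx (f : C -> C) (z : C) : C :=
  (Derive (fun t => Re (f (t, Im z))) (Re z),
   Derive (fun t => Im (f (t, Im z))) (Re z)).

Definition dy (f : C -> C) (z : C) : C :=
  (Derive (fun t => Re (f (Re z, t))) (Im z),
   Derive (fun t => Im (f (Re z, t))) (Im z)).

Definition d_z (f : C -> C) (z : C) : C := ((dx f z - Ci * dy f z) / 2)%C.
Definition d_zbar (f : C -> C) (z : C) : C := ((dx f z + Ci * dy f z) / 2)%C.

Definition jacobian (f : C -> C) (z : C) : R :=
  Re (dx f z) * Im (dy f z) - Re (dy f z) * Im (dx f z).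

Definition sense_preserving (f : C -> C) : Prop :=
  forall z : C, unit_disk z -> 0 < jacobian f z.

Definition S_H (f : harmonic_map) : Prop :=
  analytic_in_disk (hpart f) /\ analytic_in_disk (gpart f) /\
  hpart f 0 = 0 /\ gpart f 0 = 0 /\
  univalent f /\ sense_preserving f /\
  f 0 = 0 /\ d_z f 0 = 1.

Definition S_H0 (f : harmonic_map) : Prop := S_H f /\ d_zbar f 0 = 0.

(** The image of a mapping in [S_H0] is automatically open and connected. *)
Definition K_H0 (f : harmonic_map) : Prop :=
  S_H0 f /\ convex_set (disk_image f).

Definition dilatation (f : harmonic_map) (z : C) : C :=
  (C_derive (gpart f) z / C_derive (hpart f) z)%C.

Definition convex_in_real_direction (f : C -> C) : Prop :=
  univalent f /\ convex_in_direction 0 (disk_image f).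

(** ** Convolution *)

Definition taylor_coeff (f : C -> C) (n : nat) : C :=
  (Nat.iter n C_derive f 0 / INR (fact n))%C.

Definition CSeries (u : nat -> C) : C :=
  (Series (fun n => Re (u n)), Series (fun n => Im (u n))).

(** The sum runs over exponents [n >= 1], hence the successor. *)
Definition hadamard (F f : C -> C) (z : C) : C :=
  CSeries (fun n =>
    taylor_coeff F (S n) * taylor_coeff f (S n) * z ^ S n)%C.

Definition convolution (F f : harmonic_map) : harmonic_map :=
  HarmonicMap (hadamard (hpart F) (hpart f)) (hadamard (gpart F) (gpart f)).

Definition hscale (c : R) (f : harmonic_map) : harmonic_map :=
  HarmonicMap (fun z => c * hpart f z)%C (fun z => c * gpart f z)%C.

(** ** The right half-plane mapping *)

Definition F_ (a : R) : harmonic_map :=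
  HarmonicMap
    (fun z => (/ (1 + a) * z - / 2 * z ^ 2) / (1 - z) ^ 2)%C
    (fun z => (a / (1 + a) * z - / 2 * z ^ 2) / (1 - z) ^ 2)%C.

(* Main.v *)
Require Import Defs.
From Stdlib Require Import Reals Factorial Lra Lia ClassicalEpsilon.
From Coquelicot Require Import Coquelicot.
Open Scope R_scope.

(** Write [c = (1 - a) / (1 + a)], so that [0 < c <= 1].  The coefficients of
    [H_a] and [G_a] are [(1 + c n) / 2] and [(1 - c n) / 2], hence the convolution is
    [Phi + conj Psi] with [Phi = (h + c z h') / 2] and [Psi = (g - c z g') / 2].
    Its real part is that of [Phi + Psi = (h + g + c z (h' - g')) / 2], its imaginary
    part that of [Phi - Psi = (h - g + c z (h' + g')) / 2].

    With [D = (1 + z e^(i beta)) (1 + z e^(-i beta))], [omega = e^(i theta) z^2],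
    [P = (1 - omega) / (1 + omega)] and [p = (1 - z^2) / D], the hypotheses give
    [h' + g' = 1 / D] and [h' - g' = P / D], and differentiation yields

      [2 D (Phi - Psi)' = P + c p],    [2 D (Phi + Psi)' = 1 + c (P p + P^2 - 1)],

    where [z P' = P^2 - 1] because [omega] is a constant multiple of [z^2].  Both [P] and [p] have
    positive real part.  For any two such numbers and [0 < c <= 1] the product of the
    second factor with the conjugate of the first has positive real part
    ([convolution_positivity], an explicit sum of nonnegative terms); this is
    exactly positivity of the Jacobian.

    Univalence and convexity in the real direction come from one geometric argument.
    The Moebius map [z |-> (e^(i beta) + z) / (1 + z e^(i beta))] followed by the
    logarithm carries the disk to the strip [0 < Im tau < PI], where [p] becomes
    [sinh tau / (i sin beta)].  In the variable [tau] the positivity of [Re (P + c p)] says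
    that [Im (Phi - Psi)] increases along each horizontal line of the strip, at a rate
    bounded below on that line because [c > 0].  So each level set of the
    imaginary part is a graph over the interval [(0, PI)], and positivity of the Jacobian
    makes the real part strictly monotone along that graph ([shear_injective],
    [shear_level_connected]).  Hence the map is injective, and every horizontal line
    meets the image in the continuous image of an interval.

    The convolution is defined through Taylor coefficients of [h] and [g].  Since [h']
    is [1] divided by four factors [1 - u z] with [|u| = 1], its expansion is built
    by repeated division by such factors ([expands_div]), and that of [h] by integration
    ([expands_antiderivative]). *)

(** * Complex differentiation *)

Definition is_Cderive (f : C -> C) (z l : C) : Prop :=
  @is_derive C_AbsRing C_NormedModule f z l.

Lemma C_ext (z w : C) : Re z = Re w -> Im z = Im w -> z = w.
Proof. destruct z, w; simpl; intros; subst; reflexivity. Qed.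

Lemma is_Cderive_eps (f : C -> C) (z l : C) :
  is_Cderive f z l <->
  (forall eps, 0 < eps -> exists delta, 0 < delta /\
    forall w, Cmod (w - z) < delta ->
      Cmod (f w - f z - (w - z) * l) <= eps * Cmod (w - z)).
Proof.
  split.
  - intros [_ H] eps Heps.
    destruct (H z (fun P HP => HP) (mkposreal eps Heps)) as [d Hd].
    exists d; split; [apply cond_pos|]. intros w Hw. exact (Hd w Hw).
  - intros H. split.
    + apply (@is_linear_scal_l C_AbsRing C_NormedModule).
    + intros x Hx. apply (@is_filter_lim_locally_unique) in Hx. subst x.
      intros eps. destruct (H eps (cond_pos eps)) as [d [Hd H']].
      exists (mkposreal d Hd). intros w Hw. exact (H' w Hw).
Qed.

(** [C] is a normed module over itself in two ways that differ in the uniform structure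
    only; the general product rule is about [AbsRing_NormedModule C_AbsRing]. *)
Lemma is_Cderive_regular (f : C -> C) (z l : C) :
  is_Cderive f z l <->
  @is_derive C_AbsRing (AbsRing_NormedModule C_AbsRing) f z l.
Proof.
  split; intros [[L1 L2 L3] H]; (split; [split; assumption|exact H]).
Qed.

Lemma is_Cderive_ext_disk (f g : C -> C) (z l : C) :
  unit_disk z -> (forall w, unit_disk w -> f w = g w) ->
  is_Cderive f z l -> is_Cderive g z l.
Proof.
  intros Hz Hfg. apply is_derive_ext_loc.
  assert (H : 0 < 1 - Cmod z) by (unfold unit_disk in Hz; lra).
  exists (mkposreal _ H). intros w Hw. apply Hfg.
  change (Cmod (w - z) < 1 - Cmod z) in Hw. unfold unit_disk in *.
  replace w with ((w - z) + z)%C by ring.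
  pose proof (Cmod_triangle (w - z) z). lra.
Qed.

Lemma is_Cderive_const (c z : C) : is_Cderive (fun _ => c) z 0%C.
Proof. exact (@is_derive_const C_AbsRing C_NormedModule c z). Qed.

Lemma is_Cderive_id (z : C) : is_Cderive (fun w => w) z 1%C.
Proof. apply is_Cderive_regular. exact (@is_derive_id C_AbsRing z). Qed.

Lemma is_Cderive_plus (f g : C -> C) (z a b : C) :
  is_Cderive f z a -> is_Cderive g z b ->
  is_Cderive (fun w => f w + g w)%C z (a + b)%C.
Proof. exact (@is_derive_plus C_AbsRing C_NormedModule f g z a b). Qed.

Lemma is_Cderive_minus (f g : C -> C) (z a b : C) :
  is_Cderive f z a -> is_Cderive g z b ->
  is_Cderive (fun w => f w - g w)%C z (a - b)%C.
Proof. exact (@is_derive_minus C_AbsRing C_NormedModule f g z a b). Qed.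

Lemma is_Cderive_mult (f g : C -> C) (z a b : C) :
  is_Cderive f z a -> is_Cderive g z b ->
  is_Cderive (fun w => f w * g w)%C z (a * g z + f z * b)%C.
Proof.
  rewrite !is_Cderive_regular. intros Hf Hg.
  exact (@is_derive_mult C_AbsRing f g z a b Hf Hg Cmult_comm).
Qed.

Lemma is_Cderive_comp (f g : C -> C) (z a b : C) :
  is_Cderive f (g z) a -> is_Cderive g z b ->
  is_Cderive (fun w => f (g w)) z (b * a)%C.
Proof.
  rewrite (is_Cderive_regular g).
  exact (@is_derive_comp C_AbsRing C_NormedModule f g z a b).
Qed.

Lemma is_Cderive_inv_id (z : C) :
  z <> 0%C -> is_Cderive (fun w => / w)%C z (- / (z * z))%C.
Proof.
  intros Hz. apply is_Cderive_eps. intros eps Heps.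
  assert (Hz' := proj1 (Cmod_gt_0 z) Hz). set (m := Cmod z) in *.
  assert (0 < m ^ 3) by (apply pow_lt; lra).
  exists (Rmin (m / 2) (eps * m ^ 3 / 2)). split.
  { apply Rmin_glb_lt; [lra|]. apply Rdiv_lt_0_compat; [nra|lra]. }
  intros w Hw.
  assert (H1 : Cmod (w - z) < m / 2) by (eapply Rlt_le_trans; [apply Hw|apply Rmin_l]).
  assert (H2 : Cmod (w - z) < eps * m ^ 3 / 2)
    by (eapply Rlt_le_trans; [apply Hw|apply Rmin_r]).
  assert (Hm : m / 2 <= Cmod w).
  { pose proof (Cmod_triangle (z - w) w) as T.
    replace (z - w + w)%C with z in T by ring. fold m in T.
    replace (z - w)%C with (- (w - z))%C in T by ring. rewrite Cmod_opp in T. lra. }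
  assert (Hw0 : w <> 0%C).
  { intros ->. rewrite Cmod_0 in Hm. lra. }
  replace (/ w - / z - (w - z) * - / (z * z))%C
    with ((w - z) * (w - z) * / (w * (z * z)))%C by (field; auto).
  rewrite !Cmod_mult, Cmod_inv, !Cmod_mult.
  2:{ apply Cmult_neq_0; [|apply Cmult_neq_0]; auto. }
  fold m. set (d := Cmod (w - z)) in *.
  assert (0 <= d) by apply Cmod_ge_0.
  assert (Hb : m ^ 3 / 2 <= Cmod w * (m * m)) by nra.
  assert (0 < Cmod w * (m * m)) by lra.
  apply Rmult_le_reg_r with (Cmod w * (m * m)); [lra|].
  rewrite Rmult_assoc, Rinv_l by lra.
  assert (d <= eps * (Cmod w * (m * m))) by nra.
  nra.
Qed.

Lemma is_Cderive_inv (f : C -> C) (z a : C) :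
  f z <> 0%C -> is_Cderive f z a ->
  is_Cderive (fun w => / f w)%C z (a * - / (f z * f z))%C.
Proof.
  intros Hz Hf. apply (is_Cderive_comp (fun w => / w)%C f); [|exact Hf].
  apply is_Cderive_inv_id, Hz.
Qed.

Lemma is_Cderive_unique (f : C -> C) (z a b : C) :
  is_Cderive f z a -> is_Cderive f z b -> a = b.
Proof.
  intros Ha Hb. rewrite <- (is_C_derive_unique f z a Ha).
  apply is_C_derive_unique, Hb.
Qed.

Lemma ex_Cderive_is (f : C -> C) (z : C) :
  @ex_derive C_AbsRing C_NormedModule f z -> is_Cderive f z (C_derive f z).
Proof.
  intros [l Hl]. rewrite (is_C_derive_unique f z l Hl). exact Hl.
Qed.

Lemma Cmult_Re (a b : C) : Re (a * b) = Re a * Re b - Im a * Im b.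
Proof. reflexivity. Qed.
Lemma Cmult_Im (a b : C) : Im (a * b) = Re a * Im b + Im a * Re b.
Proof. reflexivity. Qed.

Lemma im_le_Cmod (c : C) : Rabs (Im c) <= Cmod c.
Proof.
  eapply Rle_trans; [|apply Rmax_Cmod]. apply Rmax_r.
Qed.

Lemma Cmod_le_abs (c : C) : Cmod c <= Rabs (Re c) + Rabs (Im c).
Proof.
  replace c with (RtoC (Re c) + Ci * RtoC (Im c))%C
    by (apply C_ext; simpl; ring).
  eapply Rle_trans; [apply Cmod_triangle|].
  rewrite Cmod_mult, Cmod_Ci, !Cmod_R. simpl.
  right. f_equal; [f_equal; ring|]. rewrite Rmult_1_l. f_equal. ring.
Qed.

(** The differential of a complex-differentiable [f] is multiplication by [l], so along a
    real curve with velocity [(x', y')] the components of [f] move with velocity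
    [l * (x', y')]. *)
Lemma is_Cderive_chain (f : C -> C) (x y : R -> R) (t : R) (l : C) (x' y' : R) :
  is_Cderive f (x t, y t) l -> is_derive x t x' -> is_derive y t y' ->
  is_derive (fun s => Re (f (x s, y s))) t (Re (l * (x', y'))) /\
  is_derive (fun s => Im (f (x s, y s))) t (Im (l * (x', y'))).
Proof.
  intros Hf Hx Hy.
  assert (Hlin : forall w : C,
    Cmod w = @norm _ (prod_NormedModule _ R_NormedModule R_NormedModule) w).
  { intros w. unfold Cmod. unfold norm at 1. simpl. unfold prod_norm, norm. simpl.
    unfold abs. simpl. f_equal. rewrite !Rmult_1_r, <- !Rabs_mult, !Rabs_right; nra. }
  assert (Hfil : forall (g : C -> R) , 
     (forall a b, g (a - b)%C = g a - g b) ->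
     (forall (k : R) a, g (k * a)%C = k * g a) ->
     (forall a, Rabs (g a) <= Cmod a) ->
     is_derive (fun s => g (f (x s, y s))) t (g (l * (x', y'))%C)).
  { intros g Hgm Hgs Hgn.
    assert (Hgp : forall a b, g (a + b)%C = g a + g b).
    { intros a b. replace (a + b)%C with (a - (RtoC (-1) * b))%C by (apply C_ext; simpl; ring).
      rewrite Hgm, Hgs. ring. }
    assert (K := @filterdiff_comp'_2 R_AbsRing R_NormedModule R_NormedModule R_NormedModule
       R_NormedModule x y (fun a b => g (f (a, b))) t
       (fun s => scal s x') (fun s => scal s y')
       (fun a b => g (l * (a, b))%C) Hx Hy).
    assert (E : filterdiff (fun s => g (f (x s, y s))) (locally t)
       (fun s => g (l * (scal s x', scal s y'))%C)).
    { apply K. split.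
      - split.
        + intros [a b] [a' b']. simpl. rewrite <- Hgp. f_equal.
          apply C_ext; simpl; unfold plus; simpl; ring.
        + intros k [a b]. simpl. unfold scal at 3; simpl. unfold mult; simpl. rewrite <- Hgs. f_equal.
          apply C_ext; simpl; unfold scal; simpl; unfold mult; simpl; ring.
        + exists (Cmod l + 1). split; [pose proof (Cmod_ge_0 l); lra|].
          intros [a b]. simpl. eapply Rle_trans; [apply Hgn|].
          rewrite Cmod_mult. rewrite <- Hlin. 
          pose proof (Cmod_ge_0 (a,b)). pose proof (Cmod_ge_0 l).
          apply Rmult_le_compat_r; [assumption|]. apply Rlt_le, Rlt_plus_1.
      - intros z Hz. apply (@is_filter_lim_locally_unique) in Hz. subst z.
        intros eps.
        destruct (proj1 (is_Cderive_eps _ _ _) Hf eps (cond_pos eps)) as [d [Hd H]].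
        assert (Hd2 : 0 < d / 2) by lra.
        exists (mkposreal _ Hd2). intros [a b] [Ha Hb]. simpl.
        rewrite <- Hlin.
        change (Rabs (a - x t) < d / 2) in Ha. change (Rabs (b - y t) < d / 2) in Hb.
        assert (Hn : Cmod ((a, b) - (x t, y t))%C < d).
        { eapply Rle_lt_trans; [apply Cmod_le_abs|]. simpl. 
          unfold Rminus in Ha, Hb. lra. }
        specialize (H (a, b) Hn).
        eapply Rle_trans; [|exact H].
        eapply Rle_trans; [|apply Hgn].
        right. unfold norm; simpl. unfold abs; simpl. f_equal.
        rewrite !Hgm. unfold minus, plus, opp; simpl. unfold Rminus. f_equal. f_equal. f_equal.
        apply C_ext; simpl; ring. }
    eapply filterdiff_ext_lin; [exact E|]. intros s. simpl.
    unfold scal at 3; simpl; unfold mult; simpl. rewrite <- Hgs. f_equal.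
    apply C_ext; simpl; unfold scal; simpl; unfold mult; simpl; ring. }
  split; apply Hfil.
  - reflexivity.
  - intros; unfold Re; simpl; ring.
  - apply re_le_Cmod.
  - reflexivity.
  - intros; unfold Im; simpl; ring.
  - apply im_le_Cmod.
Qed.

Lemma harmonic_partials f z H G :
  is_Cderive (hpart f) z H -> is_Cderive (gpart f) z G ->
  dx f z = (H + Cconj G)%C /\ dy f z = (Ci * (H - Cconj G))%C.
Proof.
  intros Hh Hg.
  destruct z as [x y].
  assert (D1 : forall t, is_derive (fun s : R => s) t 1) by (intros; apply (@is_derive_id R_AbsRing)).
  assert (D0 : forall c t, is_derive (fun _ : R => c) t 0)
    by (intros; apply (@is_derive_const R_AbsRing R_NormedModule)).
  destruct (is_Cderive_chain (hpart f) (fun s => s) (fun _ => y) x H 1 0 Hh (D1 _) (D0 _ _)) as [A1 A2].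
  destruct (is_Cderive_chain (gpart f) (fun s => s) (fun _ => y) x G 1 0 Hg (D1 _) (D0 _ _)) as [B1 B2].
  destruct (is_Cderive_chain (hpart f) (fun _ => x) (fun s => s) y H 0 1 Hh (D0 _ _) (D1 _)) as [A3 A4].
  destruct (is_Cderive_chain (gpart f) (fun _ => x) (fun s => s) y G 0 1 Hg (D0 _ _) (D1 _)) as [B3 B4].
  assert (R1 := is_derive_plus _ _ _ _ _ A1 B1).
  assert (R2 := is_derive_minus _ _ _ _ _ A2 B2).
  assert (R3 := is_derive_plus _ _ _ _ _ A3 B3).
  assert (R4 := is_derive_minus _ _ _ _ _ A4 B4).
  split; unfold dx, dy; apply C_ext; unfold Re at 1, Im at 1; simpl fst; simpl snd.
  - erewrite is_derive_unique; [|exact R1]. unfold plus, Re, Im; simpl; ring.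
  - erewrite is_derive_unique; [|exact R2]. unfold minus, plus, opp, Re, Im; simpl; ring.
  - erewrite is_derive_unique; [|exact R3]. unfold plus, Re, Im; simpl; ring.
  - erewrite is_derive_unique; [|exact R4]. unfold minus, plus, opp, Re, Im; simpl; ring.
Qed.

Lemma harmonic_jacobian f z H G :
  is_Cderive (hpart f) z H -> is_Cderive (gpart f) z G ->
  jacobian f z = Re ((H + G) * Cconj (H - G))%C.
Proof.
  intros Hh Hg. destruct (harmonic_partials f z H G Hh Hg) as [E1 E2].
  unfold jacobian. rewrite E1, E2. unfold Re, Im; simpl. ring.
Qed.

(** * Complex power series *)

(** Convergence is taken componentwise so that it determines [CSeries], which is itself
    defined by components. *)
Definition is_Cseries (u : nat -> C) (l : C) : Prop :=
  is_series (fun n => Re (u n)) (Re l) /\ is_series (fun n => Im (u n)) (Im l).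

Lemma is_Cseries_unique u l : is_Cseries u l -> CSeries u = l.
Proof.
  intros [H1 H2]. unfold CSeries.
  rewrite (is_series_unique _ _ H1), (is_series_unique _ _ H2).
  apply C_ext; reflexivity.
Qed.

Lemma is_Cseries_plus u v l m :
  is_Cseries u l -> is_Cseries v m -> is_Cseries (fun n => u n + v n)%C (l + m)%C.
Proof.
  intros [H1 H2] [H3 H4].
  split; [exact (is_series_plus _ _ _ _ H1 H3)|exact (is_series_plus _ _ _ _ H2 H4)].
Qed.

Lemma is_Cseries_scal c u l :
  is_Cseries u l -> is_Cseries (fun n => c * u n)%C (c * l)%C.
Proof.
  intros [H1 H2]; split.
  - exact (is_series_minus _ _ _ _ (is_series_scal (Re c) _ _ H1)
             (is_series_scal (Im c) _ _ H2)).
  - exact (is_series_plus _ _ _ _ (is_series_scal (Re c) _ _ H2)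
             (is_series_scal (Im c) _ _ H1)).
Qed.

Lemma is_Cseries_ext u v l :
  (forall n, u n = v n) -> is_Cseries u l -> is_Cseries v l.
Proof.
  intros E [H1 H2]; split; (eapply is_series_ext; [|eassumption]);
    intros n; simpl; rewrite E; reflexivity.
Qed.

Lemma is_Cseries_minus u v l m :
  is_Cseries u l -> is_Cseries v m -> is_Cseries (fun n => u n - v n)%C (l - m)%C.
Proof.
  intros H1 H2.
  replace (l - m)%C with (l + (-1) * m)%C by ring.
  apply is_Cseries_ext with (fun n => u n + (-1) * v n)%C; [intros; ring|].
  apply is_Cseries_plus; [exact H1|apply is_Cseries_scal, H2].
Qed.

Lemma is_Cseries_tail u l :
  is_Cseries u l -> is_Cseries (fun n => u (S n)) (l - u 0%nat)%C.
Proof.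
  intros [H1 H2]; split.
  - apply (is_series_incr_1 (fun n => Re (u n))).
    replace (plus _ _) with (Re l); [exact H1|]. unfold plus, Re; simpl. ring.
  - apply (is_series_incr_1 (fun n => Im (u n))).
    replace (plus _ _) with (Im l); [exact H2|]. unfold plus, Im; simpl. ring.
Qed.

Lemma is_Cseries_cons u l :
  is_Cseries (fun n => u (S n)) l -> is_Cseries u (l + u 0%nat)%C.
Proof.
  intros [H1 H2]; split.
  - apply (is_series_decr_1 (fun n => Re (u n))).
    replace (plus _ _) with (Re l); [exact H1|]. unfold plus, opp, Re; simpl. ring.
  - apply (is_series_decr_1 (fun n => Im (u n))).
    replace (plus _ _) with (Im l); [exact H2|]. unfold plus, opp, Im; simpl. ring.
Qed.

(** The factor [2] comes from estimating the real and the imaginary part separately. *)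
Lemma is_Cseries_dominated u b :
  (forall n, Cmod (u n) <= b n) -> ex_series b ->
  is_Cseries u (CSeries u) /\ Cmod (CSeries u) <= 2 * Series b.
Proof.
  intros Hb Eb.
  assert (K : forall v : nat -> R, (forall n, Rabs (v n) <= b n) ->
     is_series v (Series v) /\ Rabs (Series v) <= Series b).
  { intros v Hv.
    assert (Ev : ex_series (fun n => Rabs (v n))).
    { apply (@ex_series_le R_AbsRing R_CompleteNormedModule) with b; [|exact Eb].
      intros n. unfold norm; simpl. unfold abs; simpl. rewrite Rabs_Rabsolu. apply Hv. }
    split.
    - apply Series_correct, ex_series_Rabs, Ev.
    - eapply Rle_trans; [apply Series_Rabs, Ev|]. apply Series_le; [|exact Eb].
      intros n; split; [apply Rabs_pos|apply Hv]. }
  destruct (K (fun n => Re (u n))) as [H1 H2].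
  { intros n. eapply Rle_trans; [apply re_le_Cmod|apply Hb]. }
  destruct (K (fun n => Im (u n))) as [H3 H4].
  { intros n. eapply Rle_trans; [apply im_le_Cmod|apply Hb]. }
  split; [split; [exact H1|exact H3]|].
  eapply Rle_trans; [apply Cmod_le_abs|]. unfold CSeries, Re at 1, Im at 1; simpl. lra.
Qed.

(** A radius of convergence at least [1], in the Cauchy-Hadamard form: terms bounded for
    each [r < 1].  A bound on the terms passes to quotients by [1 - u z] more directly
    than a bound on the coefficients. *)
Definition radius_ge_1 (a : nat -> C) : Prop :=
  forall r, 0 < r < 1 -> exists M, 0 <= M /\ forall n, Cmod (a n) * r ^ n <= M.

Definition psum (a : nat -> C) (z : C) : C := CSeries (fun n => a n * z ^ n)%C.

Definition psderiv (a : nat -> C) (n : nat) : C := (INR (S n) * a (S n))%C.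

Lemma radius_dominated a r :
  radius_ge_1 a -> 0 <= r < 1 -> ex_series (fun n => Cmod (a n) * r ^ n).
Proof.
  intros Ha Hr.
  destruct (Ha ((1 + r) / 2)) as [M [HM H]]; [lra|].
  set (r' := (1 + r) / 2) in *. assert (0 < r') by (unfold r'; lra).
  apply (@ex_series_le R_AbsRing R_CompleteNormedModule)
    with (fun n => scal M ((r / r') ^ n)).
  - intros n. unfold norm, scal; simpl. unfold abs, mult; simpl.
    assert (0 <= Cmod (a n)) by apply Cmod_ge_0.
    assert (0 <= r ^ n) by (apply pow_le; lra).
    rewrite Rabs_right by nra.
    assert (E : r ^ n = (r / r') ^ n * r' ^ n).
    { rewrite <- Rpow_mult_distr. f_equal. field. lra. }
    rewrite E. specialize (H n).
    assert (0 <= (r / r') ^ n). { apply pow_le. apply Rdiv_le_0_compat; lra. }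
    nra.
  - apply (@ex_series_scal R_AbsRing R_NormedModule). apply ex_series_geom. rewrite Rabs_right.
    + apply Rmult_lt_reg_r with r'; [lra|]. unfold Rdiv. rewrite Rmult_assoc, Rinv_l by lra.
      unfold r'. lra.
    + apply Rle_ge, Rdiv_le_0_compat; lra.
Qed.

Lemma psum_correct a z :
  radius_ge_1 a -> unit_disk z -> is_Cseries (fun n => a n * z ^ n)%C (psum a z).
Proof.
  intros Ha Hz.
  apply is_Cseries_dominated with (fun n => Cmod (a n) * Cmod z ^ n).
  - intros n. rewrite Cmod_mult, Cmod_pow. lra.
  - apply radius_dominated; [exact Ha|]. split; [apply Cmod_ge_0|exact Hz].
Qed.

Lemma psum_0 a : psum a 0%C = a 0%nat.
Proof.
  apply is_Cseries_unique.
  assert (E : a 0%nat = (0 + a 0%nat * 0 ^ 0)%C) by (simpl; ring).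
  rewrite E.
  apply is_Cseries_cons with (u := fun n => (a n * 0 ^ n)%C).
  apply is_Cseries_ext with (fun _ => 0%C).
  - intros n. simpl. ring.
  - split; apply is_series_Reals; intros eps He; exists 0%nat; intros n _;
      rewrite sum_eq_R0; try (intros; reflexivity);
      unfold Rdist; simpl; rewrite Rminus_0_r, Rabs_R0; exact He.
Qed.

(** The bound [1 / (1 - q)] is the sum [1 + q + q^2 + ...], which dominates the sum of its
    first [n + 1] terms, each at least [q ^ n]. *)
Lemma mul_geom_bounded q : 0 < q < 1 -> exists M, 0 <= M /\ forall n, INR (S n) * q ^ n <= M.
Proof.
  intros Hq. exists (1 / (1 - q)). split; [apply Rdiv_le_0_compat; lra|].
  assert (K : forall n, INR (S n) * q ^ n * (1 - q) <= 1 - q ^ (S n)).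
  { induction n as [|n IH].
    - simpl. lra.
    - rewrite S_INR.
      assert (q ^ S n = q * q ^ n) by reflexivity.
      assert (q ^ S (S n) = q * (q * q ^ n)) by reflexivity.
      assert (0 <= q ^ n) by (apply pow_le; lra).
      rewrite H0, H. rewrite H in IH.
      assert (q * (INR (S n) * q ^ n * (1 - q)) <= q * (1 - q * q ^ n)) by nra.
      assert (0 <= (1-q)*(1 - q * q^n)).
      { apply Rmult_le_pos; [lra|]. pose proof (pow_incr q 1 (S n) ltac:(lra)) as H3.
        rewrite pow1 in H3. simpl in H3. lra. }
      nra. }
  intros n. specialize (K n). assert (0 <= q ^ S n) by (apply pow_le; lra).
  apply Rmult_le_reg_r with (1 - q); [lra|].
  unfold Rdiv. rewrite Rmult_1_l, Rinv_l by lra. lra.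
Qed.

Lemma radius_mul_n a :
  radius_ge_1 a -> radius_ge_1 (fun n => INR (S n) * a n)%C.
Proof.
  intros Ha r Hr.
  destruct (Ha ((1 + r) / 2)) as [M [HM H]]; [lra|].
  set (r' := (1 + r) / 2) in *. assert (0 < r') by (unfold r'; lra).
  destruct (mul_geom_bounded (r / r')) as [N [HN K]].
  { split; [apply Rdiv_lt_0_compat; lra|].
    apply Rmult_lt_reg_r with r'; [lra|]. unfold Rdiv. rewrite Rmult_assoc, Rinv_l by lra.
    unfold r'. lra. }
  exists (N * M). split; [nra|]. intros n. specialize (H n); specialize (K n).
  rewrite Cmod_mult, Cmod_R, Rabs_right by (apply Rle_ge, pos_INR).
  assert (E : r ^ n = (r / r') ^ n * r' ^ n).
  { rewrite <- Rpow_mult_distr. f_equal. field. lra. }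
  rewrite E.
  replace (INR (S n) * Cmod (a n) * ((r / r') ^ n * r' ^ n))
    with ((INR (S n) * (r / r') ^ n) * (Cmod (a n) * r' ^ n)) by ring.
  apply Rmult_le_compat; try assumption.
  - apply Rmult_le_pos; [apply pos_INR|apply pow_le, Rdiv_le_0_compat; lra].
  - apply Rmult_le_pos; [apply Cmod_ge_0|apply pow_le; lra].
Qed.

Lemma radius_shift a : radius_ge_1 a -> radius_ge_1 (fun n => a (S n)).
Proof.
  intros Ha r Hr. destruct (Ha r Hr) as [M [HM H]].
  exists (M / r). split; [apply Rdiv_le_0_compat; lra|].
  intros n. specialize (H (S n)). simpl in H.
  apply Rmult_le_reg_r with r; [lra|]. unfold Rdiv. rewrite (Rmult_assoc M), Rinv_l by lra. lra.
Qed.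

Lemma radius_psderiv a : radius_ge_1 a -> radius_ge_1 (psderiv a).
Proof.
  intros Ha. exact (radius_mul_n _ (radius_shift a Ha)).
Qed.

Lemma radius_le a b :
  (forall n, Cmod (b n) <= Cmod (a n)) -> radius_ge_1 a -> radius_ge_1 b.
Proof.
  intros Hab Ha r Hr. destruct (Ha r Hr) as [M [HM H]].
  exists M; split; [exact HM|]. intros n. specialize (H n); specialize (Hab n).
  assert (0 <= r ^ n) by (apply pow_le; lra). nra.
Qed.

Lemma radius_plus a b :
  radius_ge_1 a -> radius_ge_1 b -> radius_ge_1 (fun n => a n + b n)%C.
Proof.
  intros Ha Hb r Hr. destruct (Ha r Hr) as [M [HM H]]. destruct (Hb r Hr) as [N [HN K]].
  exists (M + N); split; [lra|]. intros n. specialize (H n); specialize (K n).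
  assert (0 <= r ^ n) by (apply pow_le; lra).
  pose proof (Cmod_triangle (a n) (b n)). nra.
Qed.

(** Taylor estimate of order two for powers.  The error [e n] satisfies
    [e (n + 1) = w * e n + (w - z)^2 (n + 1) z^n], from which the bound follows by
    induction; multiplying by [rho] avoids the exponent [n - 1]. *)
Lemma pow_second_order (w z : C) rho n :
  0 < rho -> Cmod z <= rho -> Cmod w <= rho ->
  Cmod (w ^ S n - z ^ S n - (w - z) * (INR (S n) * z ^ n))%C * rho
    <= Cmod (w - z) ^ 2 * INR (S n) ^ 2 * rho ^ n.
Proof.
  intros Hr Hz Hw. set (e := fun n => (w ^ S n - z ^ S n - (w - z) * (INR (S n) * z ^ n))%C).
  change (Cmod (e n) * rho <= Cmod (w - z) ^ 2 * INR (S n) ^ 2 * rho ^ n).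
  set (d := Cmod (w - z)).
  induction n as [|n IH].
  - assert (E : e 0%nat = 0%C) by (unfold e; simpl; ring).
    rewrite E, Cmod_0. simpl. pose proof (pow2_ge_0 d). simpl in *. nra.
  - assert (E : e (S n) = (w * e n + (w - z) * (w - z) * (INR (S n) * z ^ n))%C).
    { unfold e. rewrite (S_INR (S n)), RtoC_plus. simpl (_ ^ S _)%C. ring. }
    rewrite E.
    assert (T := Cmod_triangle (w * e n) ((w - z) * (w - z) * (INR (S n) * z ^ n))).
    rewrite !Cmod_mult, Cmod_pow, Cmod_R, Rabs_right in T by (apply Rle_ge, pos_INR).
    fold d in T. rewrite (S_INR (S n)). set (N := INR (S n)) in *.
    assert (0 <= N) by apply pos_INR.
    assert (0 <= Cmod (e n)) by apply Cmod_ge_0.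
    assert (0 <= Cmod z) by apply Cmod_ge_0.
    assert (0 <= Cmod w) by apply Cmod_ge_0.
    assert (Hp : Cmod z ^ n <= rho ^ n) by (apply pow_incr; lra).
    assert (0 <= Cmod z ^ n) by (apply pow_le; lra).
    assert (0 < rho ^ n) by (apply pow_lt; lra).
    simpl (rho ^ S n).
    assert (T1 : Cmod w * Cmod (e n) * rho <= rho * (d ^ 2 * N ^ 2 * rho ^ n)).
    { replace (Cmod w * Cmod (e n) * rho) with (Cmod w * (Cmod (e n) * rho)) by ring.
      apply Rmult_le_compat; try assumption; nra. }
    assert (T2 : d * d * (N * Cmod z ^ n) <= d ^ 2 * (N * rho ^ n)).
    { simpl. rewrite Rmult_1_r. apply Rmult_le_compat_l; [nra|]. apply Rmult_le_compat_l; lra. }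
    assert (T3 : d * d * (N * Cmod z ^ n) * rho <= d ^ 2 * (N * rho ^ n) * rho)
      by (apply Rmult_le_compat_r; lra).
    assert (0 <= d ^ 2 * (N + 1) * (rho * rho ^ n)).
    { apply Rmult_le_pos; [|nra]. apply Rmult_le_pos; [nra|lra]. }
    eapply Rle_trans; [apply Rmult_le_compat_r; [lra|exact T]|].
    nra.
Qed.

(** Termwise differentiation: by [pow_second_order] the remainder is at most
    [|w - z|^2] times a convergent series. *)
Lemma psum_derive a z :
  radius_ge_1 a -> unit_disk z -> is_Cderive (psum a) z (psum (psderiv a) z).
Proof.
  intros Ha Hz. apply is_Cderive_eps. intros eps Heps.
  set (rho := (1 + Cmod z) / 2). unfold unit_disk in Hz.
  assert (Hz0 := Cmod_ge_0 z).
  assert (Hrho : 0 < rho < 1) by (unfold rho; lra).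
  set (b := fun n => Cmod (INR (S n) * psderiv a n)%C * rho ^ n).
  assert (Eb : ex_series b).
  { apply (radius_dominated (fun n => INR (S n) * psderiv a n)%C); [|lra].
    apply radius_mul_n, radius_psderiv, Ha. }
  set (M := 2 * Series b / rho).
  assert (HM : 0 <= M).
  { unfold M. apply Rdiv_le_0_compat; [|lra].
    assert (0 <= Series b); [|lra].
    eapply Rle_trans; [apply Rabs_pos|]. 
    eapply Rle_trans; [apply (Series_Rabs (fun _ => 0))|].
    - apply ex_series_ext with (fun n => scal 0 (b n)).
      + intros n. rewrite Rabs_R0. unfold scal; simpl. unfold mult; simpl. ring.
      + apply (@ex_series_scal R_AbsRing R_NormedModule), Eb.
    - apply Series_le; [|exact Eb]. intros n. rewrite Rabs_R0. split; [lra|].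
      apply Rmult_le_pos; [apply Cmod_ge_0|apply pow_le; lra]. }
  exists (Rmin (rho - Cmod z) (eps / (M + 1))). split.
  { apply Rmin_glb_lt; [unfold rho; lra|apply Rdiv_lt_0_compat; lra]. }
  intros w Hw.
  assert (H1 : Cmod (w - z) < rho - Cmod z) by (eapply Rlt_le_trans; [apply Hw|apply Rmin_l]).
  assert (H2 : Cmod (w - z) < eps / (M + 1)) by (eapply Rlt_le_trans; [apply Hw|apply Rmin_r]).
  assert (Hwr : Cmod w <= rho).
  { pose proof (Cmod_triangle (w - z) z) as T. replace (w - z + z)%C with w in T by ring. lra. }
  set (d := Cmod (w - z)) in *. assert (Hd : 0 <= d) by apply Cmod_ge_0.
  set (u := fun n => (a (S n) * (w ^ S n - z ^ S n - (w - z) * (INR (S n) * z ^ n)))%C).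
  assert (Hu : is_Cseries u (psum a w - psum a z - (w - z) * psum (psderiv a) z)%C).
  { assert (Sw := is_Cseries_tail _ _ (psum_correct a w Ha ltac:(unfold unit_disk; lra))).
    assert (Sz := is_Cseries_tail _ _ (psum_correct a z Ha Hz)).
    assert (Sd := psum_correct (psderiv a) z (radius_psderiv a Ha) Hz).
    assert (K := is_Cseries_minus _ _ _ _ (is_Cseries_minus _ _ _ _ Sw Sz)
                   (is_Cseries_scal (w - z) _ _ Sd)).
    simpl in K.
    replace (psum a w - psum a z - (w - z) * psum (psderiv a) z)%C with
      (psum a w - a 0%nat * 1 - (psum a z - a 0%nat * 1) - (w - z) * psum (psderiv a) z)%C by ring.
    eapply is_Cseries_ext; [|exact K]. intros n. unfold u, psderiv. simpl (_ ^ S _)%C. ring. }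
  assert (Hub : forall n, Cmod (u n) <= scal (d ^ 2 / rho) (b n)).
  { intros n. unfold u. rewrite Cmod_mult.
    assert (P := pow_second_order w z rho n ltac:(lra) ltac:(unfold rho; lra) Hwr).
    fold d in P. change (scal (d ^ 2 / rho) (b n)) with (d ^ 2 / rho * b n).
    unfold b, psderiv.
    rewrite !Cmod_mult, Cmod_R, Rabs_right by (apply Rle_ge, pos_INR).
    set (N := INR (S n)) in *.
    set (X := Cmod _) in P. fold X. 
    assert (0 <= Cmod (a (S n))) by apply Cmod_ge_0.
    apply Rmult_le_reg_r with rho; [lra|].
    replace (d ^ 2 / rho * (N * (N * Cmod (a (S n))) * rho ^ n) * rho)
      with (Cmod (a (S n)) * (d ^ 2 * N ^ 2 * rho ^ n)) by (field; lra).
    rewrite Rmult_assoc. apply Rmult_le_compat_l; [assumption|exact P]. }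
  assert (Esb : ex_series (fun n => scal (d ^ 2 / rho) (b n)))
    by apply (@ex_series_scal R_AbsRing R_NormedModule), Eb.
  destruct (is_Cseries_dominated u _ Hub Esb) as [_ B].
  rewrite (is_Cseries_unique _ _ Hu) in B.
  eapply Rle_trans; [exact B|].
  change (fun n => scal (d ^ 2 / rho) (b n)) with (fun n => d ^ 2 / rho * b n).
  rewrite Series_scal_l.
  replace (2 * (d ^ 2 / rho * Series b)) with (M * d * d) by (unfold M; field; lra).
  apply Rmult_le_compat_r; [exact Hd|].
  assert (d * (M + 1) <= eps).
  { apply Rmult_le_reg_r with (/ (M + 1)); [apply Rinv_0_lt_compat; lra|].
    rewrite Rmult_assoc, Rinv_r by lra. unfold Rdiv in H2. lra. }
  nra.
Qed.

Lemma iter_psderiv a k n :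
  Nat.iter k psderiv a n = (INR (fact (n + k)) / INR (fact n) * a (n + k)%nat)%C.
Proof.
  assert (F : forall m, RtoC (INR (fact m)) <> 0%C).
  { intros m E. apply (INR_fact_neq_0 m). apply RtoC_inj, E. }
  revert n. induction k as [|k IH]; intros n.
  - simpl. rewrite Nat.add_0_r. field. apply F.
  - change (Nat.iter (S k) psderiv a) with (psderiv (Nat.iter k psderiv a)).
    unfold psderiv at 1. rewrite IH.
    replace (n + S k)%nat with (S n + k)%nat by lia.
    change (fact (S n)) with (S n * fact n)%nat. rewrite mult_INR, RtoC_mult.
    field. split; [apply F|]. intros E. apply RtoC_inj in E.
    pose proof (lt_0_INR (S n) ltac:(lia)). lra.
Qed.

(** [a] is the Taylor sequence of [f] at [0], see [expands_taylor]. *)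
Definition expands (f : C -> C) (a : nat -> C) : Prop :=
  radius_ge_1 a /\ forall z, unit_disk z -> f z = psum a z.

Lemma unit_disk_0 : unit_disk 0%C.
Proof. unfold unit_disk. rewrite Cmod_0. lra. Qed.

Lemma expands_derive f a z :
  expands f a -> unit_disk z -> is_Cderive f z (psum (psderiv a) z).
Proof.
  intros [Ha Hf] Hz. apply is_Cderive_ext_disk with (psum a); auto.
  - intros w Hw. symmetry. apply Hf, Hw.
  - apply psum_derive; assumption.
Qed.

Lemma expands_C_derive f a : expands f a -> expands (C_derive f) (psderiv a).
Proof.
  intros H. split; [apply radius_psderiv, H|].
  intros z Hz. apply is_C_derive_unique. exact (expands_derive f a z H Hz).
Qed.

(** The iterated derivatives are those of the power series throughout the disk, so
    the [n]-th one at [0] is [n! * a n]. *)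
Lemma expands_taylor f a n : expands f a -> taylor_coeff f n = a n.
Proof.
  intros H.
  assert (K : forall k, expands (Nat.iter k C_derive f) (Nat.iter k psderiv a)).
  { induction k as [|k IH]; [exact H|]. exact (expands_C_derive _ _ IH). }
  unfold taylor_coeff. rewrite (proj2 (K n) _ unit_disk_0), psum_0, iter_psderiv.
  simpl. field. intros E; apply RtoC_inj in E.
  apply (INR_fact_neq_0 n E).
Qed.

Lemma psum_ext a b z : (forall n, a n = b n) -> psum a z = psum b z.
Proof.
  intros E. unfold psum, CSeries. f_equal; apply Series_ext; intros n; rewrite E; reflexivity.
Qed.

(** Along the segment from [0] to [z] both components have zero derivative. *)
Lemma Cderive_zero_const f :
  (forall z, unit_disk z -> is_Cderive f z 0%C) ->
  forall z, unit_disk z -> f z = f 0%C.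
Proof.
  intros H z Hz.
  assert (D : forall t, 0 <= t <= 1 ->
    is_derive (fun s => Re (f (s * Re z, s * Im z))) t 0 /\
    is_derive (fun s => Im (f (s * Re z, s * Im z))) t 0).
  { intros t Ht.
    assert (Hd : unit_disk (t * Re z, t * Im z)).
    { replace (t * Re z, t * Im z) with (t * z)%C by (apply C_ext; simpl; unfold Re, Im; ring).
      unfold unit_disk in *. rewrite Cmod_mult, Cmod_R, Rabs_right by lra.
      pose proof (Cmod_ge_0 z). nra. }
    assert (L : forall c, is_derive (fun s => s * c) t c).
    { intros c. auto_derive; [exact I|ring]. }
    destruct (is_Cderive_chain f (fun s => s * Re z) (fun s => s * Im z) t 0%C
               (Re z) (Im z) (H _ Hd) (L _) (L _)) as [H1 H2].
    split; [replace 0 with (Re (0 * (Re z, Im z))%C)|replace 0 with (Im (0 * (Re z, Im z))%C)];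
      try assumption; simpl; ring. }
  assert (E0 : (0 * Re z, 0 * Im z) = RtoC 0) by (apply C_ext; simpl; ring).
  assert (E1 : (1 * Re z, 1 * Im z) = z) by (apply C_ext; simpl; unfold Re, Im; ring).
  apply C_ext.
  - assert (K := eq_is_derive (fun s => Re (f (s * Re z, s * Im z))) 0 1
      (fun t Ht => proj1 (D t Ht)) Rlt_0_1).
    simpl in K. rewrite E0, E1 in K. symmetry; exact K.
  - assert (K := eq_is_derive (fun s => Im (f (s * Re z, s * Im z))) 0 1
      (fun t Ht => proj2 (D t Ht)) Rlt_0_1).
    simpl in K. rewrite E0, E1 in K. symmetry; exact K.
Qed.

Lemma expands_one : expands (fun _ => 1%C) (fun n => match n with O => 1%C | _ => 0%C end).
Proof.
  split.
  - intros r Hr. exists 1. split; [lra|]. intros [|n].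
    + rewrite Cmod_1. simpl. lra.
    + rewrite Cmod_0. lra.
  - intros z Hz. symmetry. apply is_Cseries_unique.
    set (u := fun n => (match n with O => 1%C | _ => 0%C end * z ^ n)%C).
    assert (K : is_Cseries (fun n => u (S n)) (0 * psum (fun _ => 0%C) z)%C).
    { apply is_Cseries_ext with (fun n => 0 * (0 * z ^ n))%C; [intros; unfold u; ring|].
      apply is_Cseries_scal, psum_correct; [|exact Hz].
      intros r Hr. exists 0. split; [lra|]. intros n. rewrite Cmod_0. lra. }
    apply is_Cseries_cons in K.
    replace (0 * psum (fun _ => 0%C) z + u 0%nat)%C with (RtoC 1) in K
      by (unfold u; simpl; ring).
    exact K.
Qed.

Lemma expands_minus f g a b :
  expands f a -> expands g b ->
  expands (fun z => f z - g z)%C (fun n => a n - b n)%C.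
Proof.
  intros [Ha Hf] [Hb Hg]. split.
  - apply (radius_plus a (fun n => - b n)%C Ha).
    apply radius_le with b; [|exact Hb]. intros n. rewrite Cmod_opp. lra.
  - intros z Hz. rewrite Hf, Hg by exact Hz. symmetry. apply is_Cseries_unique.
    eapply is_Cseries_ext; [|exact (is_Cseries_minus _ _ _ _
      (psum_correct a z Ha Hz) (psum_correct b z Hb Hz))].
    intros n. simpl. ring.
Qed.

Lemma one_minus_neq_0 (u z : C) : Cmod u <= 1 -> unit_disk z -> (1 - u * z)%C <> 0%C.
Proof.
  intros Hu Hz E. assert (u * z = 1)%C.
  { replace (u * z)%C with (1 - (1 - u * z))%C by ring. rewrite E. ring. }
  assert (K : Cmod (u * z) = 1) by (rewrite H; apply Cmod_1).
  rewrite Cmod_mult in K. unfold unit_disk in Hz.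
  pose proof (Cmod_ge_0 z). pose proof (Cmod_ge_0 u). nra.
Qed.

(** Coefficients of the quotient of [sum a_n z^n] by [1 - u z], obtained by comparing
    coefficients in [(1 - u z) * sum b_n z^n = sum a_n z^n]. *)
Fixpoint geom_div (u : C) (a : nat -> C) (n : nat) : C :=
  match n with
  | O => a O
  | S m => (u * geom_div u a m + a (S m))%C
  end.

(** Since [|u| <= 1], the recursion [b_(n+1) = u b_n + a_(n+1)] gives
    [|b_n| r^n <= M / (1 - r)] whenever [|a_n| r^n <= M], so the quotient converges on the
    disk. *)
Lemma expands_div f a u :
  Cmod u <= 1 -> expands f a ->
  expands (fun z => f z / (1 - u * z))%C (geom_div u a).
Proof.
  intros Hu [Ha Hf].
  assert (Hr : radius_ge_1 (geom_div u a)).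
  { intros r Hr. destruct (Ha r Hr) as [M [HM H]].
    exists (M / (1 - r)). split; [apply Rdiv_le_0_compat; lra|].
    intros n. apply Rmult_le_reg_r with (1 - r); [lra|].
    unfold Rdiv. rewrite (Rmult_assoc M), Rinv_l, Rmult_1_r by lra.
    induction n as [|n IH].
    - specialize (H 0%nat). simpl in *. pose proof (Cmod_ge_0 (a 0%nat)). nra.
    - specialize (H (S n)). simpl geom_div. simpl (r ^ S n) in *.
      pose proof (Cmod_triangle (u * geom_div u a n) (a (S n))) as T.
      rewrite Cmod_mult in T.
      pose proof (Cmod_ge_0 (geom_div u a n)). pose proof (Cmod_ge_0 u).
      assert (0 < r ^ n) by (apply pow_lt; lra).
      set (X := Cmod (geom_div u a n)) in *. set (Y := Cmod (a (S n))) in *.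
      set (Z := Cmod (u * geom_div u a n + a (S n))%C) in *.
      assert (Z <= X + Y) by nra.
      assert (0 < r * r ^ n) by nra.
      assert (Z * (r * r ^ n) <= r * (X * r ^ n) + Y * (r * r ^ n)) by nra.
      assert (Z * (r * r ^ n) * (1 - r)
        <= (r * (X * r ^ n) + Y * (r * r ^ n)) * (1 - r)) by (apply Rmult_le_compat_r; lra).
      assert (r * (X * r ^ n * (1 - r)) <= r * M) by (apply Rmult_le_compat_l; lra).
      assert (Y * (r * r ^ n) * (1 - r) <= M * (1 - r)) by (apply Rmult_le_compat_r; lra).
      nra. }
  split; [exact Hr|]. intros z Hz. rewrite (Hf z Hz).
  assert (Sc := psum_correct _ z Hr Hz).
  assert (K1 := is_Cseries_tail _ _ Sc).
  assert (K2 := is_Cseries_plus _ _ _ _ (is_Cseries_scal (u * z) _ _ Sc)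
    (is_Cseries_tail _ _ (psum_correct a z Ha Hz))).
  assert (E : (psum (geom_div u a) z - geom_div u a 0%nat * z ^ 0
     = u * z * psum (geom_div u a) z + (psum a z - a 0%nat * z ^ 0))%C).
  { rewrite <- (is_Cseries_unique _ _ K1), <- (is_Cseries_unique _ _ K2).
    unfold CSeries. f_equal; apply Series_ext; intros n; f_equal;
      simpl geom_div; simpl (_ ^ S _)%C; ring. }
  simpl in E. 
  assert (N := one_minus_neq_0 u z Hu Hz).
  assert (E' : (psum a z = (1 - u * z) * psum (geom_div u a) z)%C).
  { replace (psum a z) with ((psum a z - a 0%nat * 1) + a 0%nat)%C by ring.
    set (P := psum (geom_div u a) z) in *.
    replace (psum a z - a 0%nat * 1)%C with (P - a 0%nat * 1 - u * z * P)%C by (rewrite E; ring).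
    ring. }
  rewrite E'. field. exact N.
Qed.

Lemma expands_antiderivative f df a :
  (forall z, unit_disk z -> is_Cderive f z (df z)) -> f 0%C = 0%C ->
  expands df a ->
  expands f (fun n => match n with O => 0%C | S m => (a m / INR (S m))%C end).
Proof.
  intros Hf Hf0 [Ha Hdf]. set (b := fun n => _).
  assert (NZ : forall n, RtoC (INR (S n)) <> 0%C).
  { intros n E. apply RtoC_inj in E. pose proof (lt_0_INR (S n) ltac:(lia)). lra. }
  assert (Hd : forall n, psderiv b n = a n).
  { intros n. unfold psderiv, b. field. apply NZ. }
  assert (Hb : radius_ge_1 b).
  { intros r Hr. destruct (Ha r Hr) as [M [HM H]]. exists M. split; [exact HM|].
    intros [|n].
    - unfold b. rewrite Cmod_0. lra.
    - unfold b. rewrite Cmod_div by apply NZ. specialize (H n).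
      rewrite Cmod_R, Rabs_right by (apply Rle_ge, pos_INR).
      assert (1 <= INR (S n)) by (change 1 with (INR 1); apply le_INR; lia).
      assert (0 <= Cmod (a n)) by apply Cmod_ge_0.
      assert (0 < r ^ n) by (apply pow_lt; lra). simpl (r ^ S n).
      assert (Cmod (a n) / INR (S n) <= Cmod (a n)).
      { apply Rmult_le_reg_r with (INR (S n)); [lra|]. unfold Rdiv.
        rewrite Rmult_assoc, Rinv_l by lra. nra. }
      assert (0 < r * r ^ n <= r ^ n) by nra.
      assert (0 <= Cmod (a n) / INR (S n)) by (apply Rdiv_le_0_compat; lra).
      nra. }
  split; [exact Hb|]. intros z Hz.
  assert (K := Cderive_zero_const (fun w => f w - psum b w)%C).
  assert (E : (f z - psum b z)%C = (f 0 - psum b 0)%C).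
  { apply K; [|exact Hz]. intros w Hw.
    replace (RtoC 0) with (df w - psum (psderiv b) w)%C.
    - apply is_Cderive_minus; [apply Hf, Hw|apply psum_derive; assumption].
    - rewrite (Hdf w Hw), (psum_ext (psderiv b) a w Hd). ring. }
  rewrite Hf0, psum_0 in E. unfold b at 2 in E.
  replace (f z) with (f z - psum b z + psum b z)%C by ring. rewrite E. ring.
Qed.

(** * Convolution with the half-plane mapping *)

(** For [c = (1 - a) / (1 + a)] this is [H_a], and for [- c] it is [G_a]; it equals
    half of [z / (1 - z) + c * (z / (1 - z)^2)]. *)
Definition half_plane_kernel (c : R) (z : C) : C :=
  (((1 + c) / 2 * z - / 2 * z ^ 2) / (1 - z) ^ 2)%C.

Definition kernel_coeff (c : R) (n : nat) : C :=
  match n with O => 0%C | S _ => ((1 + c * INR n) / 2)%C end.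

Lemma radius_bounded a M : (forall n, Cmod (a n) <= M) -> radius_ge_1 a.
Proof.
  intros H r Hr. exists M. split; [eapply Rle_trans; [apply Cmod_ge_0|apply (H 0%nat)]|].
  intros n. assert (0 < r ^ n <= 1).
  { split; [apply pow_lt; lra|]. pose proof (pow_incr r 1 n ltac:(lra)) as K.
    rewrite pow1 in K. exact K. }
  specialize (H n). pose proof (Cmod_ge_0 (a n)). nra.
Qed.

Lemma expands_geometric : expands (fun z => / (1 - z))%C (fun _ => 1%C).
Proof.
  assert (K := expands_div _ _ 1%C ltac:(rewrite Cmod_1; lra) expands_one).
  assert (E : forall n, geom_div 1 (fun n => match n with O => 1%C | _ => 0%C end) n = 1%C).
  { induction n as [|n IH]; [reflexivity|]. simpl. rewrite IH. ring. }
  destruct K as [K1 K2]. split.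
  - apply radius_le with (2 := K1). intros n. rewrite E. lra.
  - intros z Hz. rewrite <- (psum_ext _ _ z E), <- K2 by exact Hz.
    unfold Cdiv. rewrite !Cmult_1_l. reflexivity.
Qed.

Lemma expands_kernel c : expands (half_plane_kernel c) (kernel_coeff c).
Proof.
  assert (G := expands_geometric).
  assert (Hr : radius_ge_1 (kernel_coeff c)).
  { apply radius_le with (fun n => INR (S n) * RtoC (1 + Rabs c))%C.
    - intros [|n].
      + simpl. rewrite Cmod_0. apply Cmod_ge_0.
      + unfold kernel_coeff. rewrite <- RtoC_mult, <- RtoC_mult, <- RtoC_plus, <- RtoC_div, !Cmod_R
          by lra.
        assert (0 <= INR (S n)) by apply pos_INR. rewrite (S_INR (S n)).
        rewrite (Rabs_right ((_ + 1) * _))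
          by (apply Rle_ge, Rmult_le_pos; [lra|pose proof (Rabs_pos c); lra]).
        unfold Rdiv. rewrite Rabs_mult. rewrite (Rabs_right (/ 2)) by lra.
        pose proof (Rabs_triang 1 (c * INR (S n))). rewrite Rabs_mult in H0.
        rewrite (Rabs_right 1), (Rabs_right (INR (S n))) in H0 by lra.
        pose proof (Rabs_pos c). nra.
    - apply radius_mul_n, radius_bounded with (Cmod (RtoC (1 + Rabs c))). intros; lra. }
  split; [exact Hr|]. intros z Hz. symmetry. apply is_Cseries_unique.
  assert (NZ : (1 - z)%C <> 0%C).
  { pose proof (one_minus_neq_0 1 z ltac:(rewrite Cmod_1; lra) Hz). rewrite Cmult_1_l in H. exact H. }
  assert (S1 := psum_correct _ z (proj1 G) Hz).
  rewrite <- (proj2 G z Hz) in S1.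
  assert (S2 := psum_correct _ z (radius_psderiv _ (proj1 G)) Hz).
  assert (D : psum (psderiv (fun _ => 1%C)) z = (/ ((1 - z) * (1 - z)))%C).
  { apply (is_Cderive_unique (fun w => / (1 - w))%C z).
    - apply (expands_derive _ _ z G Hz).
    - replace (/ ((1 - z) * (1 - z)))%C with ((0 - 1) * - / ((1 - z) * (1 - z)))%C by (field; exact NZ).
      apply (is_Cderive_inv (fun w => 1 - w)%C z (0 - 1)%C NZ).
      apply is_Cderive_minus; [apply is_Cderive_const|apply is_Cderive_id]. }
  rewrite D in S2.
  replace (half_plane_kernel c z) with
    (z / 2 * (/ (1 - z) + c * / ((1 - z) * (1 - z))) + kernel_coeff c 0 * z ^ 0)%C.
  2:{ unfold half_plane_kernel. simpl. field. exact NZ. }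
  apply is_Cseries_cons with (u := fun n => (kernel_coeff c n * z ^ n)%C).
  eapply is_Cseries_ext; [|apply (is_Cseries_scal (z / 2)%C), is_Cseries_plus;
    [exact S1|apply (is_Cseries_scal c), S2]].
  intros n. unfold kernel_coeff, psderiv. simpl (_ ^ S _)%C. field.
Qed.

(** Multiplying the coefficients of [f] by [1] and by [n] produces [f] and [z f']. *)
Lemma hadamard_kernel K c f a z l :
  expands K (kernel_coeff c) -> expands f a -> f 0%C = 0%C -> unit_disk z ->
  is_Cderive f z l ->
  hadamard K f z = ((f z + c * (z * l)) / 2)%C.
Proof.
  intros HK Hf Hf0 Hz Hl. rewrite <- (is_C_derive_unique _ _ _ Hl). apply is_Cseries_unique.
  assert (S1 := is_Cseries_tail _ _ (psum_correct a z (proj1 Hf) Hz)).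
  assert (S2 := psum_correct _ z (radius_psderiv _ (proj1 Hf)) Hz).
  assert (A0 : a 0%nat = 0%C).
  { rewrite <- (psum_0 a), <- (proj2 Hf _ unit_disk_0). exact Hf0. }
  rewrite <- (proj2 (expands_C_derive f a Hf) z Hz) in S2.
  rewrite <- (proj2 Hf z Hz), A0 in S1.
  replace ((f z + c * (z * C_derive f z)) / 2)%C with
    (/ 2 * ((f z - 0 * z ^ 0) + (c * z) * C_derive f z))%C by (simpl; field).
  eapply is_Cseries_ext; [|apply is_Cseries_scal, is_Cseries_plus;
    [exact S1|apply (is_Cseries_scal (c * z)%C), S2]].
  intros n. rewrite (expands_taylor _ _ _ HK), (expands_taylor _ _ _ Hf).
  unfold kernel_coeff, psderiv. simpl (_ ^ S _)%C. field.
Qed.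

(** * The exponential and the logarithm branch *)

Lemma Cexp_plus z w : Cexp (z + w) = (Cexp z * Cexp w)%C.
Proof.
  unfold Cexp, Re, Im. apply C_ext; unfold Re, Im; simpl; rewrite exp_plus, ?cos_plus, ?sin_plus; ring.
Qed.

Lemma Cexp_0 : Cexp 0 = 1%C.
Proof. unfold Cexp. apply C_ext; simpl; rewrite exp_0, ?cos_0, ?sin_0; ring. Qed.

Lemma Cmod_Cexp_i (t : R) : Cmod (Cexp (Ci * t)) = 1.
Proof.
  unfold Cexp, Cmod. simpl.
  replace (0 * t - 1 * 0) with 0 by ring. rewrite exp_0.
  replace (_ + _) with 1; [apply sqrt_1|].
  pose proof (sin2_cos2 (0 * 0 + 1 * t)) as H. unfold Rsqr in H. lra.
Qed.

Lemma real_first_order (f : R -> R) (l : R) eps :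
  is_derive f 0 l -> 0 < eps ->
  exists d, 0 < d /\ forall h, Rabs h < d -> Rabs (f h - f 0 - l * h) <= eps * Rabs h.
Proof.
  intros H Heps. apply is_derive_Reals in H. destruct (H eps Heps) as [d Hd].
  exists d. split; [apply cond_pos|]. intros h Hh.
  destruct (Req_dec h 0) as [->|Hn].
  - rewrite Rabs_R0. replace (f 0 - f 0 - l * 0) with 0 by ring. rewrite Rabs_R0. lra.
  - specialize (Hd h Hn Hh). rewrite Rplus_0_l in Hd.
    replace (f h - f 0 - l * h) with (((f h - f 0) / h - l) * h) by (field; exact Hn).
    rewrite Rabs_mult. apply Rmult_le_compat_r; [apply Rabs_pos|lra].
Qed.

(** By the addition formula it is enough to differentiate at [0], where the first-order
    expansions of [exp], [cos] and [sin] give the estimate. *)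
Lemma is_Cderive_Cexp z : is_Cderive Cexp z (Cexp z).
Proof.
  assert (H0 : is_Cderive Cexp 0 1).
  { apply is_Cderive_eps. intros eps Heps.
    set (e := Rmin 1 (eps / 16)).
    assert (He : 0 < e) by (apply Rmin_glb_lt; lra).
    assert (He1 : e <= 1) by apply Rmin_l. assert (He2 : e <= eps / 16) by apply Rmin_r. clearbody e.
    destruct (real_first_order exp 1 e) as [d1 [Hd1 K1]]; [|exact He|].
    { auto_derive; [exact I|rewrite exp_0; ring]. }
    destruct (real_first_order cos 0 e) as [d2 [Hd2 K2]]; [|exact He|].
    { auto_derive; [exact I|rewrite sin_0; ring]. }
    destruct (real_first_order sin 1 e) as [d3 [Hd3 K3]]; [|exact He|].
    { auto_derive; [exact I|rewrite cos_0; ring]. }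
    exists (Rmin e (Rmin d1 (Rmin d2 d3))). split.
    { repeat apply Rmin_glb_lt; assumption. }
    intros w Hw. replace (w - 0)%C with w in * by ring.
    assert (W1 : Cmod w < e) by (eapply Rlt_le_trans; [apply Hw|apply Rmin_l]).
    assert (Hw' : Cmod w < Rmin d1 (Rmin d2 d3)) by (eapply Rlt_le_trans; [apply Hw|apply Rmin_r]).
    assert (W2 : Cmod w < d1) by (eapply Rlt_le_trans; [apply Hw'|apply Rmin_l]).
    assert (Hw'' : Cmod w < Rmin d2 d3) by (eapply Rlt_le_trans; [apply Hw'|apply Rmin_r]).
    assert (W3 : Cmod w < d2) by (eapply Rlt_le_trans; [apply Hw''|apply Rmin_l]).
    assert (W4 : Cmod w < d3) by (eapply Rlt_le_trans; [apply Hw''|apply Rmin_r]).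
    assert (X := re_le_Cmod w). assert (Y := im_le_Cmod w).
    specialize (K1 (Re w) ltac:(lra)). specialize (K2 (Im w) ltac:(lra)).
    specialize (K3 (Im w) ltac:(lra)).
    rewrite Cexp_0. rewrite exp_0 in K1. rewrite cos_0 in K2. rewrite sin_0 in K3.
    set (m := Cmod w) in *. set (x := Re w) in *. set (y := Im w) in *.
    assert (Hm : 0 <= m) by apply Cmod_ge_0.
    assert (B1 : Rabs (exp x - 1 - x) <= e * m).
    { replace (exp x - 1 - x) with (exp x - 1 - 1 * x) by ring.
      eapply Rle_trans; [exact K1|]. apply Rmult_le_compat_l; lra. }
    assert (B2 : Rabs (cos y - 1) <= e * m).
    { replace (cos y - 1) with (cos y - 1 - 0 * y) by ring.
      eapply Rle_trans; [exact K2|]. apply Rmult_le_compat_l; lra. }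
    assert (B3 : Rabs (sin y - y) <= e * m).
    { replace (sin y - y) with (sin y - 0 - 1 * y) by ring.
      eapply Rle_trans; [exact K3|]. apply Rmult_le_compat_l; lra. }
    assert (B4 : Rabs (exp x - 1) <= 2 * m).
    { replace (exp x - 1) with ((exp x - 1 - x) + x) by ring.
      eapply Rle_trans; [apply Rabs_triang|]. nra. }
    assert (B5 : Rabs (exp x) <= 3).
    { replace (exp x) with ((exp x - 1) + 1) by ring.
      eapply Rle_trans; [apply Rabs_triang|]. rewrite (Rabs_right 1) by lra. lra. }
    eapply Rle_trans; [apply Cmod_le_abs|].
    replace (Re _) with (exp x * (cos y - 1) + (exp x - 1 - x))
      by (unfold Cexp; fold x y; unfold Re; simpl; fold x y; unfold x, y, Re, Im; ring).
    replace (Im _) with (exp x * (sin y - y) + (exp x - 1) * y)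
      by (unfold Cexp; fold x y; unfold Im; simpl; fold x y; unfold x, y, Re, Im; ring).
    assert (Rabs (exp x * (cos y - 1) + (exp x - 1 - x)) <= 3 * (e * m) + e * m).
    { eapply Rle_trans; [apply Rabs_triang|]. rewrite Rabs_mult.
      apply Rplus_le_compat; [|exact B1]. apply Rmult_le_compat; try assumption; apply Rabs_pos. }
    assert (Rabs (exp x * (sin y - y) + (exp x - 1) * y) <= 3 * (e * m) + 2 * m * e).
    { eapply Rle_trans; [apply Rabs_triang|]. rewrite !Rabs_mult.
      apply Rplus_le_compat; apply Rmult_le_compat; try assumption; try apply Rabs_pos; lra. }
    nra. }
  replace (Cexp z) with (Cexp z * 1)%C by ring.
  apply is_derive_ext with (fun w => Cexp z * Cexp (w - z))%C.
  { intros w. rewrite <- Cexp_plus. f_equal. change (z + (w - z) = w)%C. ring. }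
  assert (K : is_Cderive (fun w => Cexp (w - z)) z 1).
  { replace (RtoC 1) with ((1 - 0) * 1)%C by ring.
    apply (is_Cderive_comp Cexp (fun w => w - z)%C).
    - replace (z - z)%C with (RtoC 0) by ring. exact H0.
    - apply is_Cderive_minus; [apply is_Cderive_id|apply is_Cderive_const]. }
  replace (Cexp z * 1)%C with (0 * Cexp (z - z) + Cexp z * 1)%C by ring.
  apply (is_Cderive_mult (fun _ => Cexp z) (fun w => Cexp (w - z))); [apply is_Cderive_const|exact K].
Qed.

Lemma Cexp_neq_0 z : Cexp z <> 0%C.
Proof.
  intros E. assert (K := Cexp_plus z (- z)).
  rewrite E, Cmult_0_l in K. replace (z + - z)%C with (RtoC 0) in K by ring.
  rewrite Cexp_0 in K. apply RtoC_inj in K. lra.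
Qed.

(** * Connected curves and shears of a strip *)

Lemma connected_set_ext (S T : C -> Prop) :
  (forall w, S w <-> T w) -> connected_set S -> connected_set T.
Proof.
  intros E H [U [V [HU [HV [Hc [[x [Sx Ux]] [[y [Sy Vy]] Hd]]]]]]].
  apply H. exists U, V. repeat split; try assumption.
  - intros w Hw. apply Hc, E, Hw.
  - exists x; split; [apply E, Sx|exact Ux].
  - exists y; split; [apply E, Sy|exact Vy].
  - intros w Hw. apply Hd, E, Hw.
Qed.

(** An open separation of the curve would make the indicator of one side a locally constant
    function on the interval, with zero derivative but two values. *)
Lemma connected_curve (gamma : R -> C) (a b : R) :
  (forall t, a < t < b -> continuous gamma t) ->
  connected_set (fun w => exists t, a < t < b /\ gamma t = w).
Proof.
  intros Hc [U [V [HU [HV [Hcov [[x [[s [Hs Es]] Ux]] [[y [[t [Ht Et]] Vy]] Hdis]]]]]]].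
  subst x y.
  set (d := fun r => if excluded_middle_informative (U (gamma r)) then 1 else 0).
  assert (Hl : forall r, a < r < b -> locally r (fun r' => d r' = d r)).
  { intros r Hr.
    assert (Hin : locally r (fun r' => a < r' < b)).
    { apply (locally_interval _ r a b); simpl; try tauto. }
    destruct (classic (U (gamma r))) as [Hu|Hu].
    - assert (Hg : locally r (fun r' => U (gamma r'))) by exact (Hc r Hr U (HU _ Hu)).
      generalize Hg. apply filter_imp. intros r' H'. unfold d.
      destruct (excluded_middle_informative _), (excluded_middle_informative _); tauto.
    - assert (Hv : V (gamma r)).
      { destruct (Hcov (gamma r)); [exists r; auto|tauto|assumption]. }
      assert (Hg : locally r (fun r' => V (gamma r'))) by exact (Hc r Hr V (HV _ Hv)).
      generalize (filter_and _ _ Hin Hg). apply filter_imp.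
      intros r' [I' H']. unfold d.
      assert (~ U (gamma r')) by (intro; apply (Hdis (gamma r')); [exists r'; auto|tauto]).
      destruct (excluded_middle_informative _), (excluded_middle_informative _); tauto. }
  assert (Hd : forall r, a < r < b -> is_derive d r 0).
  { intros r Hr. apply is_derive_ext_loc with (fun _ => d r).
    - generalize (Hl r Hr). apply filter_imp. intros; congruence.
    - apply (@is_derive_const R_AbsRing R_NormedModule). }
  assert (Heq : d s = d t).
  { destruct (Rtotal_order s t) as [H|[H|H]].
    - apply (eq_is_derive d s t); [|exact H]. intros r Hr. apply Hd. lra.
    - congruence.
    - symmetry. apply (eq_is_derive d t s); [|exact H]. intros r Hr. apply Hd. lra. }
  unfold d in Heq.
  assert (~ U (gamma t)) by (intro; apply (Hdis (gamma t)); [exists t; auto|tauto]).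
  destruct (excluded_middle_informative _), (excluded_middle_informative _); tauto || lra.
Qed.

Definition strip (tau : C) : Prop := 0 < Im tau < PI.

(** Two functions [p] and [q] on the strip are combined into the map [shear] with
    components [Re p] and [Im q].  [Hdelta] makes [Im q] increase along horizontal lines;
    the lower bound [delta] depends on the line only, which makes [Im q] onto
    the reals on each line and its level sets global graphs.  [Hjac] is positivity of
    the Jacobian of the shear. *)
Section Shear.
Variables (p q p' q' : C -> C) (delta : R -> R).
Hypothesis Hp : forall tau, strip tau -> is_Cderive p tau (p' tau).
Hypothesis Hq : forall tau, strip tau -> is_Cderive q tau (q' tau).
Hypothesis delta_pos : forall psi, 0 < psi < PI -> 0 < delta psi.
Hypothesis delta_cont : forall psi, 0 < psi < PI -> continuous delta psi.
Hypothesis Hdelta : forall tau, strip tau -> delta (Im tau) <= Im (q' tau).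
Hypothesis Hjac : forall tau, strip tau -> 0 < Re (p' tau * Cconj (q' tau)).

Let v s psi := Im (q (s, psi)).

Lemma shear_v_derive s psi :
  0 < psi < PI -> is_derive (fun s => v s psi) s (Im (q' (s, psi))).
Proof.
  intros H. unfold v.
  destruct (is_Cderive_chain q (fun s => s) (fun _ => psi) s (q' (s, psi)) 1 0) as [_ K].
  - apply Hq, H.
  - apply (@is_derive_id R_AbsRing).
  - apply (@is_derive_const R_AbsRing R_NormedModule).
  - replace (Im (q' (s, psi))) with (Im (q' (s, psi) * (1, 0))%C); [exact K|].
    simpl. unfold Im; simpl. ring.
Qed.

Lemma shear_v_increase s1 s2 psi :
  0 < psi < PI -> s1 <= s2 -> delta psi * (s2 - s1) <= v s2 psi - v s1 psi.
Proof.
  intros H H12.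
  destruct (MVT_gen (fun s => v s psi) s1 s2 (fun s => Im (q' (s, psi)))) as [c [_ E]].
  - intros; apply shear_v_derive, H.
  - intros x _. apply continuity_pt_filterlim.
    apply (@ex_derive_continuous R_AbsRing R_NormedModule (fun s => v s psi)).
    exists (Im (q' (x, psi))). apply shear_v_derive, H.
  - rewrite E. apply Rmult_le_compat_r; [lra|]. apply (Hdelta (c, psi)), H.
Qed.

Lemma shear_v_expand s1 s2 psi :
  0 < psi < PI -> delta psi * Rabs (s2 - s1) <= Rabs (v s2 psi - v s1 psi).
Proof.
  intros H. destruct (Rle_dec s1 s2) as [L|L].
  - pose proof (shear_v_increase s1 s2 psi H L). rewrite (Rabs_right (s2 - s1)) by lra.
    eapply Rle_trans; [eassumption|apply Rle_abs].
  - pose proof (shear_v_increase s2 s1 psi H ltac:(lra)).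
    rewrite (Rabs_left (s2 - s1)) by lra. rewrite Rabs_minus_sym.
    eapply Rle_trans; [|apply Rle_abs]. lra.
Qed.

Lemma shear_v_onto psi k : 0 < psi < PI -> exists s, v s psi = k.
Proof.
  intros H. pose proof (delta_pos psi H) as Hd.
  set (m := Rabs (k - v 0 psi) / delta psi).
  assert (Hm : 0 <= m) by (apply Rdiv_le_0_compat; [apply Rabs_pos|lra]).
  assert (E : delta psi * m = Rabs (k - v 0 psi)) by (unfold m; field; lra).
  assert (A := shear_v_increase 0 m psi H Hm).
  assert (B := shear_v_increase (- m) 0 psi H ltac:(lra)).
  pose proof (Rle_abs (k - v 0 psi)). pose proof (Rle_abs (- (k - v 0 psi))) as X.
  rewrite Rabs_Ropp in X.
  destruct (IVT_gen (fun s => v s psi) (- m) m k) as [s [_ Hs]].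
  - intros x. apply continuity_pt_filterlim.
    apply (@ex_derive_continuous R_AbsRing R_NormedModule (fun s => v s psi)).
    exists (Im (q' (x, psi))). apply shear_v_derive, H.
  - split.
    + eapply Rle_trans; [apply Rmin_l|]. nra.
    + eapply Rle_trans; [|apply Rmax_r]. nra.
  - exists s. exact Hs.
Qed.

(** The level set [Im q = k] as a graph: its only point at height [psi] is
    [(level k psi, psi)]. *)
Definition level (k psi : R) : R := epsilon (inhabits 0) (fun s => v s psi = k).

Lemma level_spec k psi : 0 < psi < PI -> v (level k psi) psi = k.
Proof. intros H. unfold level. apply epsilon_spec, shear_v_onto, H. Qed.

Lemma level_unique k s psi : 0 < psi < PI -> v s psi = k -> s = level k psi.
Proof.
  intros H E. pose proof (shear_v_expand (level k psi) s psi H) as K.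
  rewrite E, level_spec, Rminus_diag, Rabs_R0 in K by exact H.
  pose proof (delta_pos psi H). pose proof (Rabs_pos (s - level k psi)).
  assert (Rabs (s - level k psi) = 0) by nra.
  apply Rminus_diag_uniq. destruct (Req_dec (s - level k psi) 0); [assumption|].
  pose proof (Rabs_pos_lt _ H3). lra.
Qed.

(** By [shear_v_expand] the displacement of the level curve is at most [1 / delta] times
    the change of [Im q] in the vertical direction, which is of first order in [h]. *)
Lemma level_lipschitz k psi :
  0 < psi < PI -> exists K d, 0 <= K /\ 0 < d /\ forall h, Rabs h < d ->
    0 < psi + h < PI /\ Rabs (level k (psi + h) - level k psi) <= K * Rabs h.
Proof.
  intros H. set (s0 := level k psi).
  assert (Hd := delta_pos psi H).
  destruct (delta_cont psi H (fun x => delta psi / 2 < x)) as [d1 D1].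
  { apply (locally_interval _ (delta psi) (delta psi / 2) p_infty); simpl; auto; lra. }
  destruct (proj1 (is_Cderive_eps _ _ _) (Hq (s0, psi) H) 1 Rlt_0_1) as [d2 [Hd2 D2]].
  exists ((Cmod (q' (s0, psi)) + 1) / (delta psi / 2)).
  exists (Rmin (Rmin psi (PI - psi)) (Rmin d1 d2)). repeat split.
  - apply Rdiv_le_0_compat; [pose proof (Cmod_ge_0 (q' (s0, psi)))|]; lra.
  - repeat apply Rmin_glb_lt; try lra. apply cond_pos.
  - pose proof (Rmin_l (Rmin psi (PI - psi)) (Rmin d1 d2)). pose proof (Rmin_l psi (PI - psi)).
    pose proof (Rle_abs (- h)). rewrite Rabs_Ropp in *. lra.
  - pose proof (Rmin_l (Rmin psi (PI - psi)) (Rmin d1 d2)). pose proof (Rmin_r psi (PI - psi)).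
    pose proof (Rle_abs h). lra.
  - pose proof (Rmin_l (Rmin psi (PI - psi)) (Rmin d1 d2)). pose proof (Rmin_l psi (PI - psi)).
    pose proof (Rmin_r psi (PI - psi)).
    pose proof (Rmin_r (Rmin psi (PI - psi)) (Rmin d1 d2)). pose proof (Rmin_l d1 d2).
    pose proof (Rmin_r d1 d2).
    assert (Hin : 0 < psi + h < PI).
    { pose proof (Rle_abs h). pose proof (Rle_abs (- h)). rewrite Rabs_Ropp in *. lra. }
    assert (Hdd : delta psi / 2 < delta (psi + h)).
    { apply D1. unfold ball; simpl. unfold AbsRing_ball, abs, minus, plus, opp; simpl.
      replace (psi + h + - psi) with h by ring. lra. }
    assert (Ez : ((s0, (psi + h)%R) - (s0, psi))%C = (Ci * h)%C)
      by (apply C_ext; unfold Re, Im; simpl; ring).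
    assert (En : Cmod (Ci * h) = Rabs h) by (rewrite Cmod_mult, Cmod_Ci, Cmod_R; ring).
    specialize (D2 (s0, psi + h)). rewrite Ez, En in D2. specialize (D2 ltac:(lra)).
    assert (Hv : Rabs (v s0 (psi + h) - k) <= (Cmod (q' (s0, psi)) + 1) * Rabs h).
    { rewrite <- (level_spec k psi H) at 1. fold s0. unfold v.
      replace (Im (q (s0, psi + h)) - Im (q (s0, psi)))
        with (Im (q (s0, (psi + h)%R) - q (s0, psi) - Ci * h * q' (s0, psi)
               + Ci * h * q' (s0, psi))%C) by (unfold Im; simpl; ring).
      eapply Rle_trans; [apply im_le_Cmod|]. eapply Rle_trans; [apply Cmod_triangle|].
      rewrite (Cmod_mult (Ci * h)), En. nra. }
    pose proof (shear_v_expand s0 (level k (psi + h)) (psi + h) Hin) as X.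
    rewrite level_spec in X by exact Hin. rewrite (Rabs_minus_sym k) in X.
    pose proof (Rabs_pos (level k (psi + h) - s0)).
    apply Rmult_le_reg_l with (delta psi / 2); [lra|].
    replace (delta psi / 2 * ((Cmod (q' (s0, psi)) + 1) / (delta psi / 2) * Rabs h))
      with ((Cmod (q' (s0, psi)) + 1) * Rabs h) by (field; lra).
    nra.
Qed.

(** Implicit differentiation.  Since [Im q] is constant on the curve, its first-order
    expansion reads [Re q' * h + Im q' * ds = o(|h| + |ds|)], and [ds = O(h)] by
    [level_lipschitz]. *)
Lemma level_derive k psi :
  0 < psi < PI ->
  is_derive (level k) psi
    (- Re (q' (level k psi, psi)) / Im (q' (level k psi, psi))).
Proof.
  intros H. destruct (level_lipschitz k psi H) as [K [d [HK [Hd L]]]].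
  set (s0 := level k psi) in *.
  assert (Hg : 0 < Im (q' (s0, psi))).
  { eapply Rlt_le_trans; [apply (delta_pos psi H)|]. apply (Hdelta (s0, psi)), H. }
  set (al := Re (q' (s0, psi))). set (ga := Im (q' (s0, psi))) in *.
  apply is_derive_Reals. intros eps Heps.
  assert (He : 0 < eps * ga / (2 * (K + 1))).
  { apply Rdiv_lt_0_compat; [nra|lra]. }
  destruct (proj1 (is_Cderive_eps _ _ _) (Hq (s0, psi) H) _ He) as [d2 [Hd2 D2]].
  assert (Hd' : 0 < Rmin d (d2 / (K + 1))).
  { apply Rmin_glb_lt; [exact Hd|apply Rdiv_lt_0_compat; lra]. }
  exists (mkposreal _ Hd'). intros h Hh0 Hh. simpl in Hh.
  assert (H1 : Rabs h < d) by (eapply Rlt_le_trans; [apply Hh|apply Rmin_l]).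
  assert (H2 : Rabs h < d2 / (K + 1)) by (eapply Rlt_le_trans; [apply Hh|apply Rmin_r]).
  destruct (L h H1) as [Hin HL].
  assert (Hpos := Rabs_pos_lt h Hh0).
  set (ds := level k (psi + h) - s0) in *.
  assert (Ez : ((level k (psi + h), (psi + h)%R) - (s0, psi))%C = (ds, h))
    by (apply C_ext; unfold Re, Im; simpl; unfold ds; ring).
  assert (En : Cmod (ds, h) <= (K + 1) * Rabs h).
  { eapply Rle_trans; [apply Cmod_le_abs|]. simpl. lra. }
  specialize (D2 (level k (psi + h), psi + h)). rewrite Ez in D2.
  assert (Hlt : (K + 1) * Rabs h < d2).
  { apply Rmult_lt_reg_r with (/ (K + 1)); [apply Rinv_0_lt_compat; lra|].
    replace ((K + 1) * Rabs h * / (K + 1)) with (Rabs h) by (field; lra). exact H2. }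
  specialize (D2 ltac:(lra)).
  assert (D3 := Rle_trans _ _ _ (im_le_Cmod _) D2).
  replace (Im _) with (- (ga * ds + al * h)) in D3.
  2:{ pose proof (level_spec k psi H) as A. pose proof (level_spec k (psi + h) Hin) as B.
      fold s0 in A. unfold v in A, B.
      assert (E : forall a b c : C, Im (a - b - c) = Im a - Im b - Im c) by reflexivity.
      rewrite E, A, B, Cmult_Im. unfold al, ga. simpl. ring. }
  rewrite Rabs_Ropp in D3.
  replace ((level k (psi + h) - level k psi) / h - - al / ga)
    with ((ga * ds + al * h) / (ga * h)) by (unfold ds, s0; field; lra).
  unfold Rdiv. rewrite Rabs_mult, Rabs_inv, Rabs_mult, (Rabs_right ga) by lra.
  apply Rmult_lt_reg_r with (ga * Rabs h); [nra|].
  rewrite Rmult_assoc, Rinv_l by nra. rewrite Rmult_1_r.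
  eapply Rle_lt_trans; [exact D3|].
  apply Rle_lt_trans with (eps * ga / (2 * (K + 1)) * ((K + 1) * Rabs h)).
  { apply Rmult_le_compat_l; lra. }
  replace (eps * ga / (2 * (K + 1)) * ((K + 1) * Rabs h)) with (eps * (ga * Rabs h) / 2)
    by (field; lra).
  assert (0 < eps * (ga * Rabs h)) by (apply Rmult_lt_0_compat; nra). lra.
Qed.

Definition along_level (k psi : R) : R := Re (p (level k psi, psi)).

(** The tangent of the level curve is [- conj q' / Im q'], so the derivative of [Re p]
    along it is [- Re (p' * conj q') / Im q']. *)
Lemma along_level_derive k psi :
  0 < psi < PI -> exists l, l < 0 /\ is_derive (along_level k) psi l.
Proof.
  intros H.
  destruct (is_Cderive_chain p (level k) (fun t => t) psi (p' (level k psi, psi)) _ 1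
     (Hp (level k psi, psi) H) (level_derive k psi H)
     (@is_derive_id R_AbsRing psi)) as [K _].
  eexists; split; [|exact K].
  assert (Hg : 0 < Im (q' (level k psi, psi))).
  { eapply Rlt_le_trans; [apply (delta_pos psi H)|]. apply (Hdelta (level k psi, psi)), H. }
  pose proof (Hjac (level k psi, psi) H) as J.
  set (P := p' (level k psi, psi)) in *. set (Q := q' (level k psi, psi)) in *.
  rewrite Cmult_Re. rewrite Cmult_Re in J.
  change (Re (Cconj Q)) with (Re Q) in J. change (Im (Cconj Q)) with (- Im Q) in J.
  simpl.
  replace (Re P * (- Re Q / Im Q) - Im P * 1)
    with (- ((Re P * Re Q - Im P * - Im Q) / Im Q)) by (field; lra).
  assert (0 < (Re P * Re Q - Im P * - Im Q) / Im Q) by (apply Rdiv_lt_0_compat; lra).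
  lra.
Qed.

Lemma along_level_decreasing k psi1 psi2 :
  0 < psi1 -> psi1 < psi2 -> psi2 < PI -> along_level k psi2 < along_level k psi1.
Proof.
  intros H1 H12 H2.
  assert (D : forall x, 0 < x < PI -> is_derive (along_level k) x (Derive (along_level k) x)
     /\ Derive (along_level k) x < 0).
  { intros x Hx. destruct (along_level_derive k x Hx) as [l [Hl Hd]].
    rewrite (is_derive_unique _ _ _ Hd). auto. }
  destruct (MVT_gen (along_level k) psi1 psi2 (Derive (along_level k))) as [c [Hc E]].
  - rewrite Rmin_left, Rmax_right by lra. intros x Hx. apply D. lra.
  - rewrite Rmin_left, Rmax_right by lra. intros x Hx. apply continuity_pt_filterlim.
    apply (@ex_derive_continuous R_AbsRing R_NormedModule).
    eexists. apply D. lra.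
  - rewrite Rmin_left, Rmax_right in Hc by lra.
    destruct (D c ltac:(lra)) as [_ Dc]. nra.
Qed.

Definition shear (tau : C) : C := (Re (p tau), Im (q tau)).

Lemma shear_injective tau1 tau2 :
  strip tau1 -> strip tau2 -> shear tau1 = shear tau2 -> tau1 = tau2.
Proof.
  destruct tau1 as [s1 psi1], tau2 as [s2 psi2]. unfold strip; simpl. intros H1 H2 E.
  unfold shear in E. injection E; intros E2 E1.
  assert (L1 := level_unique (v s2 psi2) s1 psi1 H1 E2).
  assert (L2 := level_unique (v s2 psi2) s2 psi2 H2 eq_refl).
  assert (E' : along_level (v s2 psi2) psi1 = along_level (v s2 psi2) psi2).
  { unfold along_level. rewrite <- L1, <- L2. exact E1. }
  assert (Ep : psi1 = psi2).
  { destruct (Rtotal_order psi1 psi2) as [L|[L|L]]; [|exact L|].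
    - pose proof (along_level_decreasing (v s2 psi2) psi1 psi2). lra.
    - pose proof (along_level_decreasing (v s2 psi2) psi2 psi1). lra. }
  rewrite L1, Ep, <- L2. reflexivity.
Qed.

Lemma shear_level_connected k :
  connected_set (fun w => Im w = k /\ exists tau, strip tau /\ shear tau = w).
Proof.
  apply connected_set_ext with
    (fun w => exists t, 0 < t < PI /\ (along_level k t, k) = w).
  - intros w. split.
    + intros [t [Ht <-]]. split; [reflexivity|]. exists (level k t, t). split; [exact Ht|].
      unfold shear, along_level. f_equal. apply level_spec, Ht.
    + intros [Hw [[s t] [Ht <-]]]. exists t. split; [exact Ht|].
      unfold shear in *. simpl in Hw. unfold along_level.
      rewrite <- (level_unique k s t Ht Hw). f_equal. symmetry; exact Hw.
  - apply connected_curve. intros t Ht.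
    destruct (along_level_derive k t Ht) as [l [_ Hl]].
    assert (Hc : continuous (along_level k) t).
    { apply (@ex_derive_continuous R_AbsRing R_NormedModule). eexists; exact Hl. }
    apply filterlim_locally. intros eps.
    generalize (proj1 (filterlim_locally _ _) Hc eps). apply filter_imp.
    intros x Hx. split; [exact Hx|apply ball_center].
Qed.

End Shear.

(** * The strip coordinate of the disk *)

Lemma Cmod_lt_sqr (z w : C) : Re z ^ 2 + Im z ^ 2 < Re w ^ 2 + Im w ^ 2 -> Cmod z < Cmod w.
Proof.
  intros H. unfold Cmod. apply sqrt_lt_1_alt. unfold Re, Im in H.
  split; [|exact H]. pose proof (pow2_ge_0 (fst z)). pose proof (pow2_ge_0 (snd z)). lra.
Qed.

Lemma Re_cayley_pos (w : C) : Cmod w < 1 -> 0 < Re ((1 - w) / (1 + w))%C.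
Proof.
  intros H.
  assert (Hm : Re w ^ 2 + Im w ^ 2 < 1).
  { rewrite <- Cmod2_alt. pose proof (Cmod_ge_0 w). nra. }
  destruct w as [x y]. simpl in Hm. unfold Re; simpl.
  assert (Hx : 0 < (1 + x) * ((1 + x) * 1) + (0 + y) * ((0 + y) * 1)) by nra.
  match goal with |- 0 < ?X => replace X with
    ((1 - x * x - y * y) / ((1 + x) * ((1 + x) * 1) + (0 + y) * ((0 + y) * 1))) by (field; lra) end.
  apply Rdiv_lt_0_compat; lra.
Qed.

Lemma Cexp_neg_Ci (t : R) : Cexp (- (Ci * t)) = Cconj (Cexp (Ci * t)).
Proof.
  unfold Cexp, Cconj. simpl.
  replace (- (0 * t - 1 * 0)) with 0 by ring. replace (0 * t - 1 * 0) with 0 by ring.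
  replace (- (0 * 0 + 1 * t)) with (- t) by ring. replace (0 * 0 + 1 * t) with t by ring.
  rewrite cos_neg, sin_neg. apply C_ext; simpl; ring.
Qed.

(** Let [e = e^(i beta)] with [sin beta > 0].  [strip_map] is the exponential, which maps
    the strip onto the upper half-plane, followed by the Moebius map of the upper half-plane
    onto the disk that sends [0] to [- e] and infinity to [- conj e], the two zeros of
    [denom]. *)
Section Strip_coordinate.
Variable e : C.
Hypothesis He : Cmod e = 1.
Hypothesis HIe : 0 < Im e.

Let eb := Cconj e.

Lemma unimodular_mult_conj : (e * eb)%C = 1%C.
Proof. unfold eb. rewrite <- Cmod2_conj, He. simpl. f_equal. ring. Qed.

Lemma unimodular_sqr : Re e ^ 2 + Im e ^ 2 = 1.
Proof. rewrite <- Cmod2_alt, He. ring. Qed.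

Lemma conj_sub_two_i_Im : eb = (e - 2 * Ci * Im e)%C.
Proof. unfold eb; apply C_ext; unfold Re, Im; simpl; ring. Qed.

Lemma one_minus_square_neq_0 : (1 - e * e)%C <> 0%C.
Proof.
  intros X. assert (Hee := unimodular_sqr). destruct e as [x y]. injection X as X1 X2.
  simpl in *. nra.
Qed.

Definition strip_map (tau : C) : C := ((Cexp tau - e) / (1 - Cexp tau * e))%C.

Definition denom (z : C) : C := ((1 + z * e) * (1 + z * eb))%C.

Lemma strip_Cexp tau : strip tau -> 0 < Im (Cexp tau).
Proof.
  intros H. unfold Cexp. simpl. apply Rmult_lt_0_compat; [apply exp_pos|].
  apply sin_gt_0; apply H.
Qed.

Lemma strip_denom_neq_0 U : 0 < Im U -> (1 - U * e)%C <> 0%C.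
Proof.
  intros HU E. assert (K : U = eb).
  { replace U with (U * (e * eb))%C by (rewrite unimodular_mult_conj; ring).
    replace (U * (e * eb))%C with (eb - (1 - U * e) * eb)%C by ring. rewrite E. ring. }
  rewrite K in HU. unfold eb, Cconj in HU. simpl in HU. unfold Im in HIe. lra.
Qed.

Lemma strip_map_disk tau : strip tau -> unit_disk (strip_map tau).
Proof.
  intros H. assert (HU := strip_Cexp tau H). unfold strip_map, unit_disk.
  assert (N := strip_denom_neq_0 _ HU). set (U := Cexp tau) in *.
  rewrite Cmod_div by exact N.
  assert (E : Cmod (1 - U * e) = Cmod (eb - U)).
  { replace (1 - U * e)%C with (e * (eb - U))%C.
    - rewrite Cmod_mult, He. ring.
    - replace (e * (eb - U))%C with (e * eb - U * e)%C by ring. rewrite unimodular_mult_conj. ring. }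
  assert (L : Cmod (U - e) < Cmod (eb - U)).
  { apply Cmod_lt_sqr. assert (0 < Im U * Im e) by (apply Rmult_lt_0_compat; assumption).
    unfold eb, Re, Im in *. clearbody U. simpl. lra. }
  rewrite <- E in L. pose proof (Cmod_ge_0 (U - e)).
  apply Rmult_lt_reg_r with (Cmod (1 - U * e)); [lra|].
  unfold Rdiv. rewrite Rmult_assoc, Rinv_l by lra. lra.
Qed.

Lemma denom_strip_map tau :
  strip tau ->
  denom (strip_map tau) =
    (- (2 * Ci * Im e) * Cexp tau * (1 - e * e) / ((1 - Cexp tau * e) * (1 - Cexp tau * e)))%C.
Proof.
  intros H. assert (N := strip_denom_neq_0 _ (strip_Cexp tau H)).
  unfold denom, strip_map. set (U := Cexp tau) in *.
  replace (1 + (U - e) / (1 - U * e) * eb)%C with (- (2 * Ci * Im e) * U / (1 - U * e))%C.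
  - field. exact N.
  - transitivity ((1 - U * e + U * eb - e * eb) / (1 - U * e))%C; [|field; exact N].
    rewrite unimodular_mult_conj, conj_sub_two_i_Im. field. exact N.
Qed.

(** In the coordinate [tau] the differential [dz / denom z] is a constant multiple
    of [dtau]: [tau] is an affine function of the logarithm of
    [(1 + z e) / (1 + z (conj e))], whose derivative is a multiple of [1 / denom z]. *)
Lemma strip_map_derive tau :
  strip tau ->
  is_Cderive strip_map tau (Ci / (2 * Im e) * denom (strip_map tau))%C.
Proof.
  intros H. assert (HU := strip_Cexp tau H).
  assert (N := strip_denom_neq_0 _ HU).
  assert (HIe' : RtoC (Im e) <> 0%C) by (intros E; apply RtoC_inj in E; lra).
  unfold strip_map at 1. unfold Cdiv.
  match goal with |- is_Cderive _ _ ?l => replace l with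
   ((Cexp tau - 0) * / (1 - Cexp tau * e) + (Cexp tau - e) *
     ((0 - (Cexp tau * e + Cexp tau * 0)) * - / ((1 - Cexp tau * e) * (1 - Cexp tau * e))))%C end.
  - apply (is_Cderive_mult (fun t => Cexp t - e)%C (fun t => / (1 - Cexp t * e))%C).
    + apply is_Cderive_minus; [apply is_Cderive_Cexp|apply is_Cderive_const].
    + apply (is_Cderive_inv (fun t => 1 - Cexp t * e)%C); [exact N|].
      apply is_Cderive_minus; [apply is_Cderive_const|].
      apply (is_Cderive_mult Cexp (fun _ => e)); [apply is_Cderive_Cexp|apply is_Cderive_const].
  - rewrite denom_strip_map by exact H. unfold strip_map. set (U := Cexp tau) in *.
    assert (HCi : (Ci * Ci)%C = (-1)%C) by (apply C_ext; simpl; ring).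
    transitivity (- (Ci * Ci) * U * (1 - e * e) / ((1 - U * e) * (1 - U * e)))%C.
    + rewrite HCi. field. exact N.
    + field. split; assumption.
Qed.

(** The ratio equals [sinh tau / (i sin beta)], with real part
    [cosh (Re tau) * sin (Im tau) / sin beta], and [cosh >= 1]. *)
Lemma kernel_ratio_bound tau :
  strip tau ->
  sin (Im tau) / Im e <= Re ((1 - strip_map tau * strip_map tau) / denom (strip_map tau))%C.
Proof.
  intros H. assert (HU := strip_Cexp tau H).
  assert (N := strip_denom_neq_0 _ HU).
  assert (HIe' : RtoC (Im e) <> 0%C) by (intros E; apply RtoC_inj in E; lra).
  assert (U0 : Cexp tau <> 0%C) by apply Cexp_neq_0.
  assert (K : ((1 - strip_map tau * strip_map tau) / denom (strip_map tau))%C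
     = (Ci * (/ Cexp tau - Cexp tau) / (2 * Im e))%C).
  { rewrite denom_strip_map by exact H. unfold strip_map. set (U := Cexp tau) in *.
    assert (HCi : (Ci * Ci)%C = (-1)%C) by (apply C_ext; simpl; ring).
    assert (Ci0 : Ci <> 0%C) by (intros E; injection E; lra).
    assert (e2 := one_minus_square_neq_0).
    transitivity (- (Ci * Ci) * (1 - U * U) / (- (2 * Ci * Im e) * U))%C.
    - rewrite HCi. field. repeat split; assumption.
    - field. repeat split; assumption. }
  rewrite K.
  assert (E1 : (/ Cexp tau)%C = Cexp (- tau)).
  { assert (E := Cexp_plus tau (- tau)). replace (tau + - tau)%C with (RtoC 0) in E by ring.
    rewrite Cexp_0 in E.
    replace (Cexp (- tau)) with (/ Cexp tau * (Cexp tau * Cexp (- tau)))%C by (field; exact U0).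
    rewrite <- E. ring. }
  rewrite E1.
  destruct tau as [s psi]. unfold strip in H. simpl in H.
  replace (Ci * (Cexp (- (s, psi)) - Cexp (s, psi)) / (2 * Im e))%C
    with (RtoC (/ (2 * Im e)) * (Ci * (Cexp (- (s, psi)) - Cexp (s, psi))))%C.
  2:{ rewrite RtoC_inv by lra. rewrite RtoC_mult. field. exact HIe'. }
  unfold Cexp, Ci. simpl. rewrite sin_neg, cos_neg.
  assert (Hs : 0 < sin psi) by (apply sin_gt_0; apply H).
  assert (X := exp_pos s). assert (Y := exp_pos (- s)).
  assert (XY : exp s * exp (- s) = 1) by (rewrite <- exp_plus, Rplus_opp_r; apply exp_0).
  assert (2 <= exp s + exp (- s)).
  { assert (0 <= (exp s - exp (- s)) ^ 2) by apply pow2_ge_0. nra. }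
  match goal with |- _ <= ?R =>
    replace R with (/ Im e * (sin psi * (exp s + exp (- s)) / 2)) by (field; lra) end.
  unfold Rdiv. rewrite (Rmult_comm (sin psi)).
  apply Rmult_le_compat_l; [apply Rlt_le, Rinv_0_lt_compat; lra|]. nra.
Qed.

Lemma polar_strip U : 0 < Im U -> exists tau, strip tau /\ Cexp tau = U.
Proof.
  intros HU.
  assert (HM : 0 < Cmod U).
  { apply Cmod_gt_0. intros E. rewrite E in HU. simpl in HU. lra. }
  set (r := Cmod U) in *.
  assert (HR : r ^ 2 = Re U ^ 2 + Im U ^ 2) by apply Cmod2_alt.
  assert (HC : -1 < Re U / r < 1).
  { split; apply Rmult_lt_reg_r with r; try lra; unfold Rdiv; rewrite Rmult_assoc, Rinv_l by lra; nra. }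
  exists (ln r, acos (Re U / r)).
  assert (Hb := acos_bound_lt (Re U / r) HC).
  split; [exact Hb|].
  unfold Cexp. simpl. rewrite exp_ln by exact HM. rewrite cos_acos, sin_acos by lra.
  apply C_ext; simpl.
  - field. lra.
  - replace (1 - (Re U / r)²) with ((Im U / r)²).
    + rewrite sqrt_Rsqr; [field; lra|]. apply Rdiv_le_0_compat; lra.
    + unfold Rsqr. apply Rmult_eq_reg_r with (r ^ 2); [|nra].
      replace ((1 - Re U / r * (Re U / r)) * r ^ 2) with (r ^ 2 - Re U ^ 2) by (field; lra).
      replace (Im U / r * (Im U / r) * r ^ 2) with (Im U ^ 2) by (field; lra).
      rewrite HR. ring.
Qed.

Lemma disk_denom_neq_0 z u : Cmod u = 1 -> unit_disk z -> (1 + z * u)%C <> 0%C.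
Proof.
  intros Hu Hz. replace (1 + z * u)%C with (1 - (- u) * z)%C by ring.
  apply one_minus_neq_0; [rewrite Cmod_opp; lra|exact Hz].
Qed.

Lemma strip_map_onto z : unit_disk z -> exists tau, strip tau /\ strip_map tau = z.
Proof.
  intros Hz.
  assert (N := disk_denom_neq_0 z e He Hz).
  destruct (polar_strip ((e + z) / (1 + z * e))%C) as [tau [Ht Et]].
  - assert (Hm : Re z ^ 2 + Im z ^ 2 < 1).
    { rewrite <- Cmod2_alt. pose proof (Cmod_ge_0 z). unfold unit_disk in Hz. nra. }
    assert (Hn : 0 < Re (1 + z * e)%C ^ 2 + Im (1 + z * e)%C ^ 2).
    { rewrite <- Cmod2_alt. apply pow_lt, Cmod_gt_0, N. }
    assert (E : ((e + z) / (1 + z * e))%C =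
       (RtoC (/ (Re (1 + z * e)%C ^ 2 + Im (1 + z * e)%C ^ 2)) * ((e + z) * Cconj (1 + z * e)))%C).
    { set (w := (1 + z * e)%C) in *. 
      assert (Ew : RtoC (Re w ^ 2 + Im w ^ 2) = (w * Cconj w)%C).
      { rewrite <- Cmod2_conj, <- Cmod2_alt, RtoC_pow. reflexivity. }
      assert (Nw : Cconj w <> 0%C).
      { intros X. apply N. rewrite <- (Cconj_conj w), X. apply C_ext; simpl; ring. }
      rewrite RtoC_inv by lra. rewrite Ew. field. split; assumption. }
    rewrite E. set (n := / _).
    assert (0 < n) by (apply Rinv_0_lt_compat, Hn).
    replace (Im (RtoC n * ((e + z) * Cconj (1 + z * e))))%C
      with (n * Im ((e + z) * Cconj (1 + z * e))%C) by (unfold Im; simpl; ring).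
    apply Rmult_lt_0_compat; [assumption|].
    assert (Hee := unimodular_sqr).
    assert (0 < Im e * (1 - (Re z ^ 2 + Im z ^ 2))) by (apply Rmult_lt_0_compat; lra).
    replace (Im ((e + z) * Cconj (1 + z * e))%C) with
      (Im e * (1 - (Re z ^ 2 + Im z ^ 2)) + Im z * (1 - (Re e ^ 2 + Im e ^ 2)))
      by (unfold Re, Im; simpl; ring).
    rewrite Hee. lra.
  - exists tau. split; [exact Ht|]. unfold strip_map. rewrite Et.
    assert (e2 := one_minus_square_neq_0).
    field. split; [exact N|].
    replace ((1 + z * e) - (e + z) * e)%C with (1 - e * e)%C by ring. exact e2.
Qed.

End Strip_coordinate.

(** * The convolution as a shear *)

(** Here [P = x + i y] and [p = s + i t] stand for two values in the right half-plane.
    Completing the square in [y + t] absorbs the only mixed term [2 c^2 x y t]; the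
    coefficients [1 - c] and [c - c^2] that remain are nonnegative since [c <= 1]. *)
Lemma convolution_positivity (c : R) (P p : C) :
  0 < c <= 1 -> 0 < Re P -> 0 < Re p ->
  0 < Re ((1 + c * (P * p + P * P - 1)) * Cconj (P + c * p))%C.
Proof.
  destruct P as [x y], p as [s t]. simpl. intros Hc Hx Hs.
  match goal with |- 0 < ?X => replace X with
    (x * ((1 - c) + c * x ^ 2 + (c - c ^ 2) * y ^ 2 + c ^ 2 * (y + t) ^ 2 + c ^ 2 * s ^ 2)
     + c * s * ((1 - c) * (1 + y ^ 2) + (1 + c) * x ^ 2)) by ring end.
  assert (0 < x ^ 2) by (apply pow_lt, Hx).
  assert (0 < s ^ 2) by (apply pow_lt, Hs).
  assert (0 < c ^ 2) by (apply pow_lt; lra).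
  assert (0 <= y ^ 2) by apply pow2_ge_0.
  assert (0 <= (y + t) ^ 2) by apply pow2_ge_0.
  assert (0 <= c - c ^ 2) by (replace (c - c ^ 2) with (c * (1 - c)) by ring;
    apply Rmult_le_pos; lra).
  assert (0 < c * x ^ 2) by (apply Rmult_lt_0_compat; lra).
  assert (0 <= (c - c ^ 2) * y ^ 2) by (apply Rmult_le_pos; lra).
  assert (0 <= c ^ 2 * (y + t) ^ 2) by (apply Rmult_le_pos; lra).
  assert (0 <= c ^ 2 * s ^ 2) by (apply Rmult_le_pos; lra).
  apply Rplus_lt_le_0_compat.
  - apply Rmult_lt_0_compat; lra.
  - apply Rmult_le_pos; [apply Rmult_le_pos; lra|].
    apply Rplus_le_le_0_compat; apply Rmult_le_pos; lra.
Qed.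

(** [s] and [d] stand for [h + g] and [h - g].  [conv_sum] and [conv_diff] are [Phi + Psi] and
    [Phi - Psi]; their derivatives are [sum_factor] and [diff_factor] divided by
    [2 * denom]. *)
Section Shear_of_convolution.
Variables (e t : C) (c : R) (s d : C -> C).
Hypothesis He : Cmod e = 1.
Hypothesis HIe : 0 < Im e.
Hypothesis Ht : Cmod t = 1.
Hypothesis Hc : 0 < c <= 1.

Definition cayley (z : C) : C := ((1 - t * z ^ 2) / (1 + t * z ^ 2))%C.
Definition kernel_ratio (z : C) : C := ((1 - z * z) / denom e z)%C.
Definition diff_factor (z : C) : C := (cayley z + c * kernel_ratio z)%C.
Definition sum_factor (z : C) : C :=
  (1 + c * (cayley z * kernel_ratio z + cayley z * cayley z - 1))%C.
Definition conv_sum (z : C) : C := ((s z + c * (z * (cayley z / denom e z))) / 2)%C.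
Definition conv_diff (z : C) : C := ((d z + c * (z / denom e z)) / 2)%C.

Hypothesis Hs : forall z, unit_disk z -> is_Cderive s z (/ denom e z)%C.
Hypothesis Hd : forall z, unit_disk z -> is_Cderive d z (cayley z / denom e z)%C.

Lemma Cmod_dilatation z : unit_disk z -> Cmod (t * z ^ 2) < 1.
Proof.
  intros Hz. rewrite Cmod_mult, Ht, Cmod_pow, Rmult_1_l. unfold unit_disk in Hz.
  pose proof (Cmod_ge_0 z). simpl. nra.
Qed.

Lemma dilatation_denom_neq_0 z : unit_disk z -> (1 + t * z ^ 2)%C <> 0%C.
Proof.
  intros Hz. replace (1 + t * z ^ 2)%C with (1 + (t * z ^ 2) * 1)%C by ring.
  apply disk_denom_neq_0; [apply Cmod_1|apply Cmod_dilatation, Hz].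
Qed.

Lemma denom_neq_0 z : unit_disk z -> denom e z <> 0%C.
Proof.
  intros Hz. apply Cmult_neq_0; apply disk_denom_neq_0; try assumption.
  rewrite Cmod_conj. exact He.
Qed.

Lemma Re_cayley z : unit_disk z -> 0 < Re (cayley z).
Proof. intros Hz. apply Re_cayley_pos, Cmod_dilatation, Hz. Qed.

Lemma is_Cderive_lin (u z : C) : is_Cderive (fun w => 1 + w * u)%C z u.
Proof.
  assert (K : is_Cderive (fun w => 1 + w * u)%C z (0 + (1 * u + z * 0))%C).
  { apply is_Cderive_plus; [apply is_Cderive_const|].
    apply (is_Cderive_mult (fun w => w) (fun _ => u)); [apply is_Cderive_id|apply is_Cderive_const]. }
  replace (0 + (1 * u + z * 0))%C with u in K by ring. exact K.
Qed.

Lemma is_Cderive_z_over_denom z :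
  unit_disk z ->
  is_Cderive (fun w => w / denom e w)%C z (kernel_ratio z / denom e z)%C.
Proof.
  intros Hz. assert (N := denom_neq_0 z Hz).
  set (D' := (e * (1 + z * Cconj e) + (1 + z * e) * Cconj e)%C).
  replace (kernel_ratio z / denom e z)%C with
    (1 * / denom e z + z * (D' * - / (denom e z * denom e z)))%C.
  - apply (is_Cderive_mult (fun w => w) (fun w => / denom e w)%C); [apply is_Cderive_id|].
    apply is_Cderive_inv; [exact N|].
    apply (is_Cderive_mult (fun w => 1 + w * e)%C (fun w => 1 + w * Cconj e)%C);
      apply is_Cderive_lin.
  - unfold kernel_ratio.
    replace (1 - z * z)%C with (denom e z - z * D')%C; [field; exact N|].
    unfold denom, D'.
    transitivity (1 - z * z * (e * Cconj e))%C; [ring|].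
    rewrite (unimodular_mult_conj e He). ring.
Qed.

Lemma is_Cderive_cayley z :
  unit_disk z ->
  is_Cderive cayley z (- (4 * t * z) / ((1 + t * z ^ 2) * (1 + t * z ^ 2)))%C.
Proof.
  intros Hz. assert (N := dilatation_denom_neq_0 z Hz).
  assert (W : is_Cderive (fun w => t * w ^ 2)%C z (2 * t * z)%C).
  { replace (2 * t * z)%C with (0 * (z ^ 2) + t * (1 * (z * 1) + z * (1 * 1 + z * 0)))%C
      by (simpl; ring).
    apply (is_Cderive_mult (fun _ => t) (fun w => w ^ 2)%C); [apply is_Cderive_const|].
    simpl. apply (is_Cderive_mult (fun w => w) (fun w => w * 1)%C); [apply is_Cderive_id|].
    apply (is_Cderive_mult (fun w => w) (fun _ => 1%C)); [apply is_Cderive_id|apply is_Cderive_const]. }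
  replace (- (4 * t * z) / ((1 + t * z ^ 2) * (1 + t * z ^ 2)))%C with
    ((0 - 2 * t * z) * / (1 + t * z ^ 2)
      + (1 - t * z ^ 2) * ((0 + 2 * t * z) * - / ((1 + t * z ^ 2) * (1 + t * z ^ 2))))%C
    by (field; exact N).
  apply (is_Cderive_mult (fun w => 1 - t * w ^ 2)%C (fun w => / (1 + t * w ^ 2))%C).
  - apply is_Cderive_minus; [apply is_Cderive_const|exact W].
  - apply (is_Cderive_inv (fun w => 1 + t * w ^ 2)%C); [exact N|].
    apply is_Cderive_plus; [apply is_Cderive_const|exact W].
Qed.

Lemma is_Cderive_comb (f g : C -> C) z a b :
  is_Cderive f z a -> is_Cderive g z b ->
  is_Cderive (fun w => (f w + c * g w) / 2)%C z ((a + c * b) / 2)%C.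
Proof.
  intros Hf Hg.
  replace ((a + c * b) / 2)%C with
    ((a + (0 * g z + c * b)) * / 2 + (f z + c * g z) * 0)%C by field.
  apply (is_Cderive_mult (fun w => f w + c * g w)%C (fun _ => / 2)%C); [|apply is_Cderive_const].
  apply is_Cderive_plus; [exact Hf|].
  apply (is_Cderive_mult (fun _ => RtoC c) g); [apply is_Cderive_const|exact Hg].
Qed.

Lemma is_Cderive_conv_diff z :
  unit_disk z -> is_Cderive conv_diff z (diff_factor z / (2 * denom e z))%C.
Proof.
  intros Hz. assert (N := denom_neq_0 z Hz).
  replace (diff_factor z / (2 * denom e z))%C with
    ((cayley z / denom e z + c * (kernel_ratio z / denom e z)) / 2)%C
    by (unfold diff_factor; field; exact N).
  apply is_Cderive_comb; [apply Hd, Hz|apply is_Cderive_z_over_denom, Hz].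
Qed.

Lemma is_Cderive_conv_sum z :
  unit_disk z -> is_Cderive conv_sum z (sum_factor z / (2 * denom e z))%C.
Proof.
  intros Hz. assert (N := denom_neq_0 z Hz). assert (N2 := dilatation_denom_neq_0 z Hz).
  replace (sum_factor z / (2 * denom e z))%C with
    ((/ denom e z + c * (kernel_ratio z / denom e z * cayley z + z / denom e z *
       (- (4 * t * z) / ((1 + t * z ^ 2) * (1 + t * z ^ 2))))) / 2)%C.
  - apply (is_Cderive_comb s (fun w => w * (cayley w / denom e w))%C); [apply Hs, Hz|].
    apply is_derive_ext with (fun w => w / denom e w * cayley w)%C.
    + intros w. change (w / denom e w * cayley w = w * (cayley w / denom e w))%C.
      unfold Cdiv. ring.
    + apply (is_Cderive_mult (fun w => w / denom e w)%C cayley);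
        [apply is_Cderive_z_over_denom, Hz|apply is_Cderive_cayley, Hz].
  - assert (E : (cayley z * cayley z - 1 =
      - (4 * t * z) * z / ((1 + t * z ^ 2) * (1 + t * z ^ 2)))%C)
      by (unfold cayley; field; exact N2).
    unfold sum_factor. 
    replace (cayley z * kernel_ratio z + cayley z * cayley z - 1)%C with
      (cayley z * kernel_ratio z + (cayley z * cayley z - 1))%C by ring.
    rewrite E. field. split; [exact N2|exact N].
Qed.

Lemma Re_kernel_ratio z : unit_disk z -> 0 < Re (kernel_ratio z).
Proof.
  intros Hz. destruct (strip_map_onto e He HIe z Hz) as [tau [Htau <-]].
  eapply Rlt_le_trans; [|apply (kernel_ratio_bound e He HIe tau Htau)].
  apply Rdiv_lt_0_compat; [|exact HIe]. apply sin_gt_0; apply Htau.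
Qed.

Lemma factors_positive z :
  unit_disk z -> 0 < Re (sum_factor z * Cconj (diff_factor z))%C.
Proof.
  intros Hz. apply convolution_positivity; [exact Hc|apply Re_cayley, Hz|apply Re_kernel_ratio, Hz].
Qed.

(** The contribution of [c * kernel_ratio] to the growth of [Im conv_diff] along a line of
    the strip. *)
Let delta (psi : R) : R := c * (sin psi / Im e) / (4 * Im e).

Lemma delta_positive psi : 0 < psi < PI -> 0 < delta psi.
Proof.
  intros H. unfold delta. assert (0 < sin psi) by (apply sin_gt_0; apply H).
  apply Rdiv_lt_0_compat; [|lra]. apply Rmult_lt_0_compat; [lra|].
  apply Rdiv_lt_0_compat; lra.
Qed.

Lemma delta_continuous psi : continuous delta psi.
Proof.
  apply (@ex_derive_continuous R_AbsRing R_NormedModule). unfold delta. auto_derive. lra.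
Qed.

(** The factor [denom] in [dz / dtau] cancels the one in the derivative of [f]. *)
Lemma strip_pullback_derive (f f' : C -> C) tau :
  (forall z, unit_disk z -> is_Cderive f z (f' z / (2 * denom e z))%C) ->
  strip tau ->
  is_Cderive (fun w => f (strip_map e w)) tau
    (RtoC (/ (4 * Im e)) * (Ci * f' (strip_map e tau)))%C.
Proof.
  intros Hf H. assert (Hz := strip_map_disk e He HIe tau H).
  assert (N := denom_neq_0 _ Hz).
  assert (HIe' : RtoC (Im e) <> 0%C) by (intros E; apply RtoC_inj in E; lra).
  replace (RtoC (/ (4 * Im e)) * (Ci * f' (strip_map e tau)))%C with
    (Ci / (2 * Im e) * denom e (strip_map e tau)
       * (f' (strip_map e tau) / (2 * denom e (strip_map e tau))))%C.
  - apply is_Cderive_comp; [apply Hf, Hz|apply (strip_map_derive e He HIe), H].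
  - rewrite RtoC_inv by lra. rewrite RtoC_mult. field. split; assumption.
Qed.

Lemma shear_data :
  (forall tau1 tau2, strip tau1 -> strip tau2 ->
     shear (fun w => conv_sum (strip_map e w)) (fun w => conv_diff (strip_map e w)) tau1 =
     shear (fun w => conv_sum (strip_map e w)) (fun w => conv_diff (strip_map e w)) tau2 ->
     tau1 = tau2) /\
  (forall k, connected_set (fun w => Im w = k /\ exists tau, strip tau /\
     shear (fun w => conv_sum (strip_map e w)) (fun w => conv_diff (strip_map e w)) tau = w)).
Proof.
  set (p' := fun tau => (RtoC (/ (4 * Im e)) * (Ci * sum_factor (strip_map e tau)))%C).
  set (q' := fun tau => (RtoC (/ (4 * Im e)) * (Ci * diff_factor (strip_map e tau)))%C).
  assert (Hp : forall tau, strip tau ->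
    is_Cderive (fun w => conv_sum (strip_map e w)) tau (p' tau)).
  { intros tau H. apply strip_pullback_derive; [apply is_Cderive_conv_sum|exact H]. }
  assert (Hq : forall tau, strip tau ->
    is_Cderive (fun w => conv_diff (strip_map e w)) tau (q' tau)).
  { intros tau H. apply strip_pullback_derive; [apply is_Cderive_conv_diff|exact H]. }
  assert (Hk : 0 < / (4 * Im e)) by (apply Rinv_0_lt_compat; lra).
  assert (Hdel : forall tau, strip tau -> delta (Im tau) <= Im (q' tau)).
  { intros tau H. assert (Hz := strip_map_disk e He HIe tau H).
    assert (E : forall (k : R) (X : C), Im (k * (Ci * X))%C = k * Re X)
      by (intros; unfold Re, Im; simpl; ring).
    unfold q'. rewrite E.
    unfold delta, Rdiv at 1. rewrite (Rmult_comm _ (/ (4 * Im e))).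
    apply Rmult_le_compat_l; [lra|].
    pose proof (Re_cayley _ Hz). pose proof (kernel_ratio_bound e He HIe tau H) as K.
    change (sin (Im tau) / Im e <= Re (kernel_ratio (strip_map e tau))) in K.
    unfold diff_factor.
    assert (E' : forall X Y : C, Re (X + c * Y)%C = Re X + c * Re Y)
      by (intros; unfold Re; simpl; ring).
    rewrite E'.
    assert (c * (sin (Im tau) / Im e) <= c * Re (kernel_ratio (strip_map e tau)))
      by (apply Rmult_le_compat_l; lra).
    lra. }
  assert (Hj : forall tau, strip tau -> 0 < Re (p' tau * Cconj (q' tau))).
  { intros tau H. assert (Hz := strip_map_disk e He HIe tau H).
    pose proof (factors_positive _ Hz) as K. unfold p', q'.
    set (A := diff_factor _) in *. set (B := sum_factor _) in *.
    set (k := / (4 * Im e)) in *.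
    clearbody A B.
    replace (Re _) with (k * k * Re (B * Cconj A)%C) by (unfold Re, Im; simpl; ring).
    apply Rmult_lt_0_compat; [nra|exact K]. }
  split.
  - exact (shear_injective _ _ p' q' delta Hp Hq delta_positive
      (fun psi _ => delta_continuous psi) Hdel Hj).
  - exact (shear_level_connected _ _ p' q' delta Hp Hq delta_positive
      (fun psi _ => delta_continuous psi) Hdel Hj).
Qed.

Definition conv_map (z : C) : C := (Re (conv_sum z), Im (conv_diff z)).

Lemma conv_map_univalent : univalent conv_map.
Proof.
  intros z1 z2 H1 H2 E.
  destruct (strip_map_onto e He HIe z1 H1) as [tau1 [T1 <-]].
  destruct (strip_map_onto e He HIe z2 H2) as [tau2 [T2 <-]].
  f_equal. apply (proj1 shear_data); assumption.
Qed.

Lemma line_0 p w : line 0 p w <-> Im w = Im p.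
Proof.
  assert (E : Cexp (Ci * 0) = 1%C).
  { replace (Ci * 0)%C with (RtoC 0) by ring. apply Cexp_0. }
  unfold line. rewrite E. split.
  - intros [r ->]. unfold Im; simpl. ring.
  - intros H. exists (Re w - Re p). apply C_ext; unfold Re, Im in *; simpl; [ring|rewrite H; ring].
Qed.

Lemma conv_map_convex : convex_in_direction 0 (disk_image conv_map).
Proof.
  intros p. eapply connected_set_ext; [|apply (proj2 shear_data (Im p))].
  intros w. rewrite line_0. split; intros [H1 H2]; (split; [exact H1|]).
  - destruct H2 as [tau [T <-]]. exists (strip_map e tau).
    split; [apply strip_map_disk; assumption|reflexivity].
  - destruct H2 as [z [Hz <-]]. destruct (strip_map_onto e He HIe z Hz) as [tau [T <-]].
    exists tau. split; [exact T|reflexivity].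
Qed.

End Shear_of_convolution.

(** * The harmonic mapping and its convolution *)

Lemma expands_ext f g a :
  (forall z, unit_disk z -> f z = g z) -> expands f a -> expands g a.
Proof.
  intros E [Ha Hf]. split; [exact Ha|]. intros z Hz. rewrite <- E by exact Hz. apply Hf, Hz.
Qed.

Lemma expands_inv_denom e : Cmod e = 1 -> exists a, expands (fun z => / denom e z)%C a.
Proof.
  intros He. assert (He' : Cmod (- e) <= 1) by (rewrite Cmod_opp; lra).
  assert (He'' : Cmod (- Cconj e) <= 1) by (rewrite Cmod_opp, Cmod_conj; lra).
  eexists. eapply expands_ext; [|exact (expands_div _ _ _ He'' (expands_div _ _ _ He' expands_one))].
  intros z Hz. simpl.
  assert (N1 := disk_denom_neq_0 z e He Hz).
  assert (N2 := disk_denom_neq_0 z (Cconj e) ltac:(rewrite Cmod_conj; exact He) Hz).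
  unfold denom.
  replace (1 - - e * z)%C with (1 + z * e)%C by ring.
  replace (1 - - Cconj e * z)%C with (1 + z * Cconj e)%C by ring.
  field. split; assumption.
Qed.

(** [1 + e^(i theta) z^2] splits as [(1 - eta z) (1 + eta z)] with
    [eta = i e^(i theta / 2)]. *)
Lemma expands_over_dilatation f a (theta : R) :
  expands f a ->
  exists b, expands (fun z => f z / (1 + Cexp (Ci * theta) * z ^ 2))%C b.
Proof.
  intros Hf. set (eta := (Ci * Cexp (Ci * (theta / 2)%R))%C).
  assert (H1 : Cmod eta <= 1) by (unfold eta; rewrite Cmod_mult, Cmod_Ci, Cmod_Cexp_i; lra).
  assert (H2 : Cmod (- eta) <= 1) by (rewrite Cmod_opp; exact H1).
  assert (E : Cexp (Ci * theta) = (- (eta * eta))%C).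
  { unfold eta.
    replace (Ci * theta)%C with (Ci * (theta / 2)%R + Ci * (theta / 2)%R)%C
      by (apply C_ext; simpl; field).
    rewrite Cexp_plus. set (u := Cexp _).
    replace (- (Ci * u * (Ci * u)))%C with (- (Ci * Ci) * (u * u))%C by ring.
    replace (Ci * Ci)%C with (RtoC (-1)) by (apply C_ext; simpl; ring). ring. }
  eexists. eapply expands_ext; [|exact (expands_div _ _ _ H1 (expands_div _ _ _ H2 Hf))].
  intros z Hz. simpl. rewrite E.
  assert (N1 := one_minus_neq_0 eta z H1 Hz).
  assert (N2 := one_minus_neq_0 (- eta) z H2 Hz).
  replace (1 + - (eta * eta) * (z * (z * 1)))%C with ((1 - - eta * z) * (1 - eta * z))%C by ring.
  field. split; assumption.
Qed.

(** Differentiate [Cexp (L z) = (1 + z e) / (1 + z (conj e))] and divide. *)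
Lemma log_derivative e L z :
  Cmod e = 1 ->
  is_log_branch (fun z => (1 + z * e) / (1 + z * Cconj e))%C L ->
  unit_disk z ->
  is_Cderive L z ((e - Cconj e) / denom e z)%C.
Proof.
  intros He [HL [_ HE]] Hz.
  assert (N1 := disk_denom_neq_0 z e He Hz).
  assert (N2 := disk_denom_neq_0 z (Cconj e) ltac:(rewrite Cmod_conj; exact He) Hz).
  assert (D := ex_Cderive_is L z (HL z Hz)).
  assert (D1 := is_Cderive_comp Cexp L z _ _ (is_Cderive_Cexp (L z)) D).
  assert (D2 : is_Cderive (fun z => (1 + z * e) / (1 + z * Cconj e))%C z
    (e * / (1 + z * Cconj e) + (1 + z * e) *
       (Cconj e * - / ((1 + z * Cconj e) * (1 + z * Cconj e))))%C).
  { apply (is_Cderive_mult (fun w => 1 + w * e)%C (fun w => / (1 + w * Cconj e))%C);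
      [apply is_Cderive_lin|].
    apply (is_Cderive_inv (fun w => 1 + w * Cconj e)%C); [exact N2|apply is_Cderive_lin]. }
  assert (D3 := is_Cderive_ext_disk _ _ _ _ Hz HE D1).
  assert (E := is_Cderive_unique _ _ _ _ D3 D2).
  rewrite (HE z Hz) in E.
  replace ((e - Cconj e) / denom e z)%C with (C_derive L z); [exact D|].
  replace (C_derive L z) with
    (C_derive L z * ((1 + z * e) / (1 + z * Cconj e)) * ((1 + z * Cconj e) / (1 + z * e)))%C
    by (field; split; assumption).
  rewrite E. unfold denom. field. split; assumption.
Qed.

(** The Jacobian is positive, so [h'] has no zero and the dilatation equation can be
    multiplied out; it then determines [h'] and [g'] from their sum. *)
Lemma derivatives_of_dilatation (f : harmonic_map) (e t : C) :
  Cmod t = 1 ->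
  analytic_in_disk (hpart f) -> analytic_in_disk (gpart f) -> sense_preserving f ->
  (forall z, unit_disk z ->
     is_Cderive (fun w => hpart f w + gpart f w)%C z (/ denom e z)%C) ->
  (forall z, unit_disk z -> dilatation f z = (t * z ^ 2)%C) ->
  forall z, unit_disk z ->
    is_Cderive (hpart f) z (/ denom e z / (1 + t * z ^ 2))%C /\
    is_Cderive (gpart f) z (/ denom e z - / denom e z / (1 + t * z ^ 2))%C.
Proof.
  intros Ht Ah Ag Hsp Hsum Hdil z Hz.
  assert (Dh := ex_Cderive_is _ z (Ah z Hz)). assert (Dg := ex_Cderive_is _ z (Ag z Hz)).
  assert (Esum := is_Cderive_unique _ _ _ _ (is_Cderive_plus _ _ _ _ _ Dh Dg) (Hsum z Hz)).
  specialize (Hdil z Hz). unfold dilatation in Hdil.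
  set (H := C_derive (hpart f) z) in *. set (G := C_derive (gpart f) z) in *.
  assert (N : H <> 0%C).
  { intros X. specialize (Hsp z Hz).
    rewrite (harmonic_jacobian f z _ _ Dh Dg), X in Hsp.
    destruct G as [x y]. unfold Re in Hsp; simpl in Hsp.
    pose proof (pow2_ge_0 x). pose proof (pow2_ge_0 y). lra. }
  assert (EG : G = (t * z ^ 2 * H)%C) by (rewrite <- Hdil; field; exact N).
  assert (EH : H = (/ denom e z / (1 + t * z ^ 2))%C).
  { rewrite <- Esum, EG. field. apply dilatation_denom_neq_0; assumption. }
  split.
  - rewrite <- EH. exact Dh.
  - rewrite <- EH, <- Esum. replace (H + G - H)%C with G by ring. exact Dg.
Qed.

Lemma S_H0_hscale (F : harmonic_map) (k : R) (H G : C -> C) :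
  0 < k ->
  (forall z, unit_disk z -> is_Cderive (hpart F) z (H z)) ->
  (forall z, unit_disk z -> is_Cderive (gpart F) z (G z)) ->
  hpart F 0%C = 0%C -> gpart F 0%C = 0%C ->
  univalent F ->
  (forall z, unit_disk z -> 0 < Re ((H z + G z) * Cconj (H z - G z))%C) ->
  (k * H 0)%C = 1%C -> G 0%C = 0%C ->
  S_H0 (hscale k F).
Proof.
  intros Hk DH DG H0 G0 UF Hpos EH EG.
  assert (Nk : RtoC k <> 0%C) by (intros X; apply RtoC_inj in X; lra).
  assert (Ck : Cconj k = k) by (apply C_ext; simpl; ring).
  assert (SH : forall z, unit_disk z -> is_Cderive (hpart (hscale k F)) z (k * H z)%C).
  { intros z Hz. replace (k * H z)%C with (0 * hpart F z + k * H z)%C by ring.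
    apply (is_Cderive_mult (fun _ => RtoC k) (hpart F)); [apply is_Cderive_const|apply DH, Hz]. }
  assert (SG : forall z, unit_disk z -> is_Cderive (gpart (hscale k F)) z (k * G z)%C).
  { intros z Hz. replace (k * G z)%C with (0 * gpart F z + k * G z)%C by ring.
    apply (is_Cderive_mult (fun _ => RtoC k) (gpart F)); [apply is_Cderive_const|apply DG, Hz]. }
  assert (Ek : forall z, hscale k F z = (k * F z)%C).
  { intros z.
    change (k * hpart F z + Cconj (k * gpart F z) = k * (hpart F z + Cconj (gpart F z)))%C.
    rewrite Cmult_conj, Ck. ring. }
  destruct (harmonic_partials (hscale k F) 0%C _ _ (SH _ unit_disk_0) (SG _ unit_disk_0))
    as [X Y].
  assert (C0 : Cconj 0 = 0%C) by (apply C_ext; simpl; ring).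
  rewrite EH, EG, Cmult_0_r, C0 in X, Y.
  assert (HCi : (Ci * Ci)%C = (-1)%C) by (apply C_ext; simpl; ring).
  repeat split.
  - intros z Hz. eexists. exact (SH z Hz).
  - intros z Hz. eexists. exact (SG z Hz).
  - simpl. rewrite H0. ring.
  - simpl. rewrite G0. ring.
  - intros z1 z2 H1 H2 E. apply UF; try assumption. rewrite !Ek in E.
    replace (F z1) with (/ k * (k * F z1))%C by (field; exact Nk).
    rewrite E. field. exact Nk.
  - intros z Hz. rewrite (harmonic_jacobian _ _ _ _ (SH z Hz) (SG z Hz)).
    replace ((k * H z + k * G z) * Cconj (k * H z - k * G z))%C
      with (RtoC (k * k) * ((H z + G z) * Cconj (H z - G z)))%C
      by (rewrite !Cminus_conj, !Cmult_conj, Ck, RtoC_mult; ring).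
    assert (ER : forall (r : R) (v : C), Re (r * v)%C = r * Re v)
      by (intros; unfold Re; simpl; ring).
    rewrite ER. apply Rmult_lt_0_compat; [nra|apply Hpos, Hz].
  - rewrite Ek. unfold hval. rewrite H0, G0, C0. ring.
  - unfold d_z. rewrite X, Y. transitivity ((1 - Ci * Ci) / 2)%C; [field|]. rewrite HCi. field.
  - unfold d_zbar. rewrite X, Y. transitivity ((1 + Ci * Ci) / 2)%C; [field|]. rewrite HCi. field.
Qed.

Lemma expands_half_plane_map (a : R) :
  0 <= a < 1 ->
  expands (hpart (F_ a)) (kernel_coeff ((1 - a) / (1 + a))) /\
  expands (gpart (F_ a)) (kernel_coeff (- ((1 - a) / (1 + a)))).
Proof.
  intros ha. set (c := (1 - a) / (1 + a)).
  assert (Na : (1 + a)%C <> 0%C)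
    by (rewrite <- RtoC_plus; intros X; apply RtoC_inj in X; lra).
  assert (Ec : RtoC c = ((1 - a) / (1 + a))%C).
  { unfold c. rewrite RtoC_div, RtoC_minus, RtoC_plus by lra. reflexivity. }
  assert (N1z : forall z, unit_disk z -> (1 - z)%C <> 0%C).
  { intros z Hz. pose proof (one_minus_neq_0 1 z ltac:(rewrite Cmod_1; lra) Hz) as X.
    rewrite Cmult_1_l in X. exact X. }
  split; (eapply expands_ext; [|apply expands_kernel]); intros z Hz;
    unfold half_plane_kernel; simpl; rewrite ?RtoC_opp, Ec; field;
    (split; [exact Na|apply N1z, Hz]).
Qed.

(* [F_ a] is not normalized: its analytic part has derivative [/ (1 + a)] at 0,
   and so has that of the convolution.  Membership in [S_H0], which requires
   [f_z(0) = 1], is therefore stated for the convolution times [1 + a]. *)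
Theorem theorem2p5 (beta theta a : R) (f : harmonic_map) (L : C -> C)
  (hbeta : 0 < beta < PI)
  (ha : 0 <= a < 1)
  (hf : K_H0 f)
  (hL : is_log_branch
          (fun z => (1 + z * Cexp (Ci * beta)) / (1 + z * Cexp (- (Ci * beta))))%C
          L)
  (hsum : forall z : C, unit_disk z ->
     (hpart f z + gpart f z = 1 / (2 * Ci * sin beta) * L z)%C)
  (hdil : forall z : C, unit_disk z ->
     dilatation f z = (Cexp (Ci * theta) * z ^ 2)%C) :
  S_H0 (hscale (1 + a) (convolution (F_ a) f)) /\
  convex_in_real_direction (convolution (F_ a) f).
Proof.
  destruct hf as [[[Ah [Ag [h0 [g0 [_ [Hsp _]]]]]] _] _].
  set (e := Cexp (Ci * beta)). set (t := Cexp (Ci * theta)).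
  set (c := (1 - a) / (1 + a)).
  assert (He : Cmod e = 1) by apply Cmod_Cexp_i.
  assert (Ht : Cmod t = 1) by apply Cmod_Cexp_i.
  assert (EIe : Im e = sin beta).
  { unfold e, Cexp. simpl. replace (0 * beta - 1 * 0) with 0 by ring. rewrite exp_0.
    replace (0 * 0 + 1 * beta) with beta by ring. ring. }
  assert (HIe : 0 < Im e) by (rewrite EIe; apply sin_gt_0; apply hbeta).
  assert (Hc : 0 < c <= 1).
  { unfold c. split; [apply Rdiv_lt_0_compat; lra|].
    apply Rmult_le_reg_r with (1 + a); [lra|]. unfold Rdiv.
    rewrite Rmult_assoc, Rinv_l by lra. lra. }
  rewrite Cexp_neg_Ci in hL. fold e in hL.
  assert (Ne : (e - Cconj e)%C = (2 * Ci * sin beta)%C).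
  { rewrite <- EIe. apply C_ext; unfold Re, Im; simpl; ring. }
  assert (Ns : (2 * Ci * sin beta)%C <> 0%C).
  { rewrite <- Ne. intros X. pose proof (f_equal Im X) as Y.
    change (Im e + - - Im e = 0) in Y. lra. }
  assert (N : forall z, unit_disk z -> denom e z <> 0%C)
    by (intros z Hz; apply denom_neq_0; assumption).
  assert (Dsum : forall z, unit_disk z ->
    is_Cderive (fun w => hpart f w + gpart f w)%C z (/ denom e z)%C).
  { intros z Hz.
    apply (is_Cderive_ext_disk (fun w => 1 / (2 * Ci * sin beta) * L w)%C); [exact Hz| |].
    - intros w Hw. symmetry. apply hsum, Hw.
    - replace (/ denom e z)%C with
        (0 * L z + 1 / (2 * Ci * sin beta) * ((e - Cconj e) / denom e z))%C.
      + apply (is_Cderive_mult (fun _ => 1 / (2 * Ci * sin beta))%C L);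
          [apply is_Cderive_const|apply log_derivative; assumption].
      + rewrite Ne. assert (Nz := N z Hz).
        set (k := (2 * Ci * sin beta)%C) in *. field. split; assumption. }
  assert (Dhg := derivatives_of_dilatation f e t Ht Ah Ag Hsp Dsum hdil).
  set (h' := fun z => (/ denom e z / (1 + t * z ^ 2))%C).
  set (g' := fun z => (/ denom e z - h' z)%C).
  assert (Dh : forall z, unit_disk z -> is_Cderive (hpart f) z (h' z)) by apply Dhg.
  assert (Dg : forall z, unit_disk z -> is_Cderive (gpart f) z (g' z)) by apply Dhg.
  assert (Esum : forall z, (h' z + g' z = / denom e z)%C) by (intros; unfold g'; ring).
  assert (Ediff : forall z, unit_disk z -> (h' z - g' z = cayley t z / denom e z)%C).
  { intros z Hz. unfold g', h', cayley. field.
    split; [apply dilatation_denom_neq_0|apply N]; assumption. }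
  assert (Ddiff : forall z, unit_disk z ->
    is_Cderive (fun w => hpart f w - gpart f w)%C z (cayley t z / denom e z)%C).
  { intros z Hz. rewrite <- Ediff by exact Hz.
    apply is_Cderive_minus; [apply Dh|apply Dg]; exact Hz. }
  destruct (expands_inv_denom e He) as [s0 Hs0].
  destruct (expands_over_dilatation _ _ theta Hs0) as [s1 Hs1].
  assert (Xh := expands_antiderivative _ _ _ Dh h0 Hs1).
  assert (Xg := expands_antiderivative _ _ _ Dg g0 (expands_minus _ _ _ _ Hs0 Hs1)).
  destruct (expands_half_plane_map a ha) as [KH KG]. fold c in KH, KG.
  set (P := conv_sum e t c (fun z => hpart f z + gpart f z)%C).
  set (Q := conv_diff e c (fun z => hpart f z - gpart f z)%C).
  set (F := convolution (F_ a) f).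
  assert (EH : forall z, unit_disk z -> ((P z + Q z) / 2)%C = hpart F z).
  { intros z Hz. change (hpart F z) with (hadamard (hpart (F_ a)) (hpart f) z).
    rewrite (hadamard_kernel _ _ _ _ _ _ KH Xh h0 Hz (Dh z Hz)).
    unfold P, Q, conv_sum, conv_diff. rewrite <- (Ediff z Hz).
    unfold Cdiv at 4. rewrite <- (Esum z). field. }
  assert (EG : forall z, unit_disk z -> ((P z - Q z) / 2)%C = gpart F z).
  { intros z Hz. change (gpart F z) with (hadamard (gpart (F_ a)) (gpart f) z).
    rewrite (hadamard_kernel _ _ _ _ _ _ KG Xg g0 Hz (Dg z Hz)).
    unfold P, Q, conv_sum, conv_diff. rewrite <- (Ediff z Hz).
    unfold Cdiv at 4. rewrite <- (Esum z), RtoC_opp. field. }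
  assert (DP := is_Cderive_conv_sum e t c _ He Ht Dsum). fold P in DP.
  assert (DQ := is_Cderive_conv_diff e t c _ He Ddiff). fold Q in DQ.
  assert (Pos := factors_positive e t c He HIe Ht Hc).
  assert (UC := conv_map_univalent e t c _ _ He HIe Ht Hc Dsum Ddiff).
  assert (CC := conv_map_convex e t c _ _ He HIe Ht Hc Dsum Ddiff).
  assert (EF : forall z, unit_disk z -> F z = (Re (P z), Im (Q z))).
  { intros z Hz. unfold hval. rewrite <- EH, <- EG by exact Hz.
    generalize (P z) (Q z). intros u v. apply C_ext; unfold Re, Im; simpl; field. }
  set (A := diff_factor e t c) in *. set (B := sum_factor e t c) in *.
  assert (DH : forall z, unit_disk z ->
    is_Cderive (hpart F) z ((B z + A z) / (4 * denom e z))%C).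
  { intros z Hz. apply (is_Cderive_ext_disk (fun z => (P z + Q z) / 2)%C); [exact Hz|exact EH|].
    replace ((B z + A z) / (4 * denom e z))%C with
      ((B z / (2 * denom e z) + A z / (2 * denom e z)) * / 2 + (P z + Q z) * 0)%C
      by (field; apply N, Hz).
    apply (is_Cderive_mult (fun w => P w + Q w)%C (fun _ => / 2)%C); [|apply is_Cderive_const].
    apply is_Cderive_plus; [apply DP|apply DQ]; exact Hz. }
  assert (DG : forall z, unit_disk z ->
    is_Cderive (gpart F) z ((B z - A z) / (4 * denom e z))%C).
  { intros z Hz. apply (is_Cderive_ext_disk (fun z => (P z - Q z) / 2)%C); [exact Hz|exact EG|].
    replace ((B z - A z) / (4 * denom e z))%C with
      ((B z / (2 * denom e z) - A z / (2 * denom e z)) * / 2 + (P z - Q z) * 0)%C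
      by (field; apply N, Hz).
    apply (is_Cderive_mult (fun w => P w - Q w)%C (fun _ => / 2)%C); [|apply is_Cderive_const].
    apply is_Cderive_minus; [apply DP|apply DQ]; exact Hz. }
  assert (UF : univalent F).
  { intros z1 z2 H1 H2 E. rewrite !EF in E by assumption. exact (UC z1 z2 H1 H2 E). }
  split.
  (* at the origin both factors equal [1 + c], and [(1 + a) (1 + c) = 2] *)
  - assert (D0 : denom e 0 = 1%C) by (unfold denom; ring).
    assert (C0 : cayley t 0 = 1%C).
    { unfold cayley. replace (t * 0 ^ 2)%C with (RtoC 0) by (simpl; ring).
      replace (1 - 0)%C with (RtoC 1) by ring. replace (1 + 0)%C with (RtoC 1) by ring. field. }
    assert (R0 : kernel_ratio e 0 = 1%C) by (unfold kernel_ratio; rewrite D0; field).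
    assert (A0 : A 0%C = (1 + c)%C) by (unfold A, diff_factor; rewrite C0, R0; ring).
    assert (B0 : B 0%C = (1 + c)%C) by (unfold B, sum_factor; rewrite C0, R0; ring).
    apply S_H0_hscale with (1 := Rplus_lt_le_0_compat 1 a Rlt_0_1 (proj1 ha))
      (2 := DH) (3 := DG); [| |exact UF| | |].
    + change (hadamard (hpart (F_ a)) (hpart f) 0 = 0)%C.
      rewrite (hadamard_kernel _ _ _ _ _ _ KH Xh h0 unit_disk_0 (Dh _ unit_disk_0)), h0.
      field.
    + change (hadamard (gpart (F_ a)) (gpart f) 0 = 0)%C.
      rewrite (hadamard_kernel _ _ _ _ _ _ KG Xg g0 unit_disk_0 (Dg _ unit_disk_0)), g0.
      field.
    + intros z Hz. assert (Nz := N z Hz). specialize (Pos z Hz).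
      set (D := denom e z) in *. set (u := (/ (2 * D))%C).
      assert (N2 : (2 * D)%C <> 0%C)
        by (apply Cmult_neq_0; [intros X; apply RtoC_inj in X; lra|exact Nz]).
      replace ((B z + A z) / (4 * D) + (B z - A z) / (4 * D))%C with (u * B z)%C
        by (unfold u; field; exact Nz).
      replace ((B z + A z) / (4 * D) - (B z - A z) / (4 * D))%C with (u * A z)%C
        by (unfold u; field; exact Nz).
      replace (u * B z * Cconj (u * A z))%C with (RtoC (Cmod u ^ 2)%R * (B z * Cconj (A z)))%C
        by (rewrite Cmod2_conj, Cmult_conj; ring).
      assert (ER : forall (r : R) (v : C), Re (r * v)%C = r * Re v)
        by (intros; unfold Re; simpl; ring).
      rewrite ER. apply Rmult_lt_0_compat; [|exact Pos].
      apply pow_lt. unfold u. rewrite Cmod_inv by exact N2.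
      apply Rinv_0_lt_compat, Cmod_gt_0, N2.
    + rewrite A0, B0, D0. unfold c. rewrite RtoC_div, RtoC_minus, RtoC_plus by lra. field.
      intros X. apply (f_equal Re) in X. simpl in X. lra.
    + rewrite A0, B0. unfold Cdiv. ring.
  - split; [exact UF|].
    intros p. eapply connected_set_ext; [|exact (CC p)].
    intros w. split; intros [H1 [z [Hz <-]]]; (split; [exact H1|]); exists z;
      (split; [exact Hz|]).
    + apply EF, Hz.
    + symmetry. apply EF, Hz.
Qed.
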